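(* Let $n\ge 2$ be a natural number, let $\langle\cdot\vert\cdot\rangle$ be an arbitrary inner product in $\mathbb{R}^n$, and let $(\mathscr{I}_m)_{m\in\mathbb{N}}$ be families of sets as in the context (each $\mathscr{I}_m$ a proper $\sigma$-ideal of subsets of $\mathbb{R}^m$, satisfying (H$_0$)-(H$_3$)). Let $(G,+)$ be an Abelian group. If a function $f\colon\mathbb{R}^n\to G$ satisfies $f(x+y)=f(x)+f(y)$ $\mathscr{I}_\bot$-(a.e.), i.e. $$\{(x,y)\in\bot^\ast : f(x+y)\neq f(x)+f(y)\}\in\mathscr{I}_{\bot^\ast},$$ then there is a unique orthogonally additive function $g\colon\mathbb{R}^n\to G$ such that $f(x)=g(x)$ $\mathscr{I}_n$-(a.e.), i.e. $\{x\in\mathbb{R}^n : f(x)\neq g(x)\}\in\mathscr{I}_n$.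
   Context: $\mathbb{N}=\{1,2,\ldots\}$. Ideals. For a non-empty set $X$, a family $\mathscr{I}\subset 2^X$ is a proper $\sigma$-ideal if: (i) $X\notin\mathscr{I}$; (ii) $A\in\mathscr{I}$, $B\subset A$ imply $B\in\mathscr{I}$; (iii) $A_k\in\mathscr{I}$ for $k\in\mathbb{N}$ implies $\bigcup_{k=1}^\infty A_k\in\mathscr{I}$. For each $m\in\mathbb{N}$, $\mathscr{I}_m$ is a given proper $\sigma$-ideal of subsets of $\mathbb{R}^m$, and these families satisfy: (H$_0$) $\{0\}\in\mathscr{I}_1$; (H$_1$) if $\varphi$ is a $\mathcal{C}^\infty$-diffeomorphism defined on an open set $U\subset\mathbb{R}^m$ (onto an open subset of $\mathbb{R}^m$) and $A\in\mathscr{I}_m$, then $\varphi(A\cap U)\in\mathscr{I}_m$; (H$_2$) if $m,n\in\mathbb{N}$ and $A\in\mathscr{I}_{m+n}$, then $\{x\in\mathbb{R}^m : A[x]\notin\mathscr{I}_n\}\in\mathscr{I}_m$, where $A[x]=\{y\in\mathbb{R}^n : (x,y)\in A\}$; (H$_3$) if $m,n\in\mathbb{N}$ and $A\in\mathscr{I}_n$, then $\mathbb{R}^m\times A\in\mathscr{I}_{m+n}$. Ideals on manifolds. An $m$-manifold $M\subset\mathbb{R}^N$ means a regular (embedded) $\mathcal{C}^\infty$ submanifold of $\mathbb{R}^N$ of dimension $m$: for every $x\in M$ there is a $\mathcal{C}^\infty$-diffeomorphism $\varphi$ defined on an open set $U\subset\mathbb{R}^N$ with $x\in U$ such that $\varphi(M\cap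 U)=\varphi(U)\cap(\mathbb{R}^m\times\{0\})$; $M$ carries the subspace topology and the differentiable structure determined by these charts. For an $m$-manifold $M$ with an atlas $\{(U_i,\varphi_i)\}_{i\in I}$ (charts $\varphi_i$ with values in $\mathbb{R}^m$) put $$\mathscr{I}_M=\{A\subset M : \varphi_i(A\cap U_i)\in\mathscr{I}_m\text{ for each }i\in I\};$$ this does not depend on the choice of the atlas of $M$, and $\mathscr{I}_{\mathbb{R}^m}=\mathscr{I}_m$. A property of $x\in M$ holds $\mathscr{I}_M$-(a.e.) if it holds for all $x\in M\setminus A$ for some $A\in\mathscr{I}_M$. Orthogonality. $\bot=\{(x,y)\in\mathbb{R}^n\times\mathbb{R}^n : \langle x\vert y\rangle=0\}$ and $\bot^\ast=\bot\setminus\{(0,0)\}$, which is a $(2n-1)$-manifold in $\mathbb{R}^{2n}$. For $Z\subset\bot$, ''$Z\in\mathscr{I}_\bot$'' means $Z\in\mathscr{I}_{\bot^\ast}$, and ''$\mathscr{I}_\bot$-(a.e.)'' means $\mathscr{I}_{\bot^\ast}$-(a.e.). A function $g\colon\mathbb{R}^n\to G$ is orthogonally additive if $g(x+y)=g(x)+g(y)$ for all $(x,y)\in\bot$. *)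

(* Defs.v *)
From HB Require Import structures.
From mathcomp Require Import all_boot all_order all_algebra.
From mathcomp Require Import all_classical all_reals all_analysis.
Set Implicit Arguments.
Unset Strict Implicit.
Unset Printing Implicit Defensive.
Import Order.TTheory GRing.Theory Num.Theory.
Import numFieldNormedType.Exports.
Local Open Scope classical_set_scope.
Local Open Scope ring_scope.

(* R^m is 'rV[R]_m and R^m x R^n is 'rV[R]_(m + n), with (x, y) = row_mx x y.
   A map defined on an open set U is represented by a total function of which
   only the values on U are used. *)

(* For U open: f is C^0 on U iff it is continuous at the points of U, and
   C^(k+1) iff it is differentiable at the points of U and, for every vector v,
   x |-> 'd f x v (a directional derivative of f) is C^k on U. *)
Fixpoint Ck_on (R : realType) (V W : normedModType R) (k : nat)
    (U : set V) (f : V -> W) : Prop :=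
  match k with
  | 0 => forall x, U x -> {for x, continuous f}
  | k'.+1 => (forall x, U x -> differentiable f x) /\
             (forall v : V, Ck_on k' U (fun x => 'd f x v))
  end.

Definition smooth_on (R : realType) (V W : normedModType R)
    (U : set V) (f : V -> W) : Prop :=
  forall k : nat, Ck_on k U f.

Definition diffeo_on (R : realType) (m : nat)
    (U : set 'rV[R]_m) (phi : 'rV[R]_m -> 'rV[R]_m) : Prop :=
  [/\ open U, open (phi @` U), smooth_on U phi &
      exists psi : 'rV[R]_m -> 'rV[R]_m,
        smooth_on (phi @` U) psi /\ (forall x, U x -> psi (phi x) = x)].

Definition proper_sigma_ideal (X : Type) (I : set (set X)) : Prop :=
  [/\ ~ I setT,
      (forall A B : set X, I A -> B `<=` A -> I B) &
      (forall A : nat -> set X, (forall k, I (A k)) -> I (\bigcup_k A k))].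

(* The families are indexed by the positive integers: I 0 is irrelevant. *)
Record ideal_system (R : realType) (I : forall m : nat, set (set 'rV[R]_m))
    : Prop := IdealSystem {
  ideal_proper : forall m, (0 < m)%N -> proper_sigma_ideal (I m);
  ideal_H0 : I 1%N [set 0];
  ideal_H1 : forall m (U : set 'rV[R]_m) (phi : 'rV[R]_m -> 'rV[R]_m)
      (A : set 'rV[R]_m),
    (0 < m)%N -> diffeo_on U phi -> I m A -> I m (phi @` (A `&` U));
  ideal_H2 : forall m n (A : set 'rV[R]_(m + n)),
    (0 < m)%N -> (0 < n)%N -> I (m + n)%N A ->
    I m [set x | ~ I n [set y | A (row_mx x y)]];
  ideal_H3 : forall m n (A : set 'rV[R]_n),
    (0 < m)%N -> (0 < n)%N -> I n A ->
    I (m + n)%N [set z | A (rsubmx z)]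
}.

(* For m <= N, right multiplication by pid_mx m : 'M_(m, N) is the inclusion
   R^m ~ R^m x {0} of R^m into R^N, and right multiplication by
   pid_mx m : 'M_(N, m) is the projection of R^N on the first m coordinates. *)
Definition slice (R : realType) (m N : nat) : set 'rV[R]_N :=
  range (fun x : 'rV[R]_m => x *m (pid_mx m : 'M[R]_(m, N))).

Definition slice_coord (R : realType) (m N : nat) (z : 'rV[R]_N) : 'rV[R]_m :=
  z *m (pid_mx m : 'M[R]_(N, m)).

Definition slice_chart (R : realType) (m N : nat) (M : set 'rV[R]_N)
    (U : set 'rV[R]_N) (phi : 'rV[R]_N -> 'rV[R]_N) : Prop :=
  diffeo_on U phi /\ phi @` (M `&` U) = phi @` U `&` @slice R m N.

(* M is an m-manifold iff every point of M lies in U for some slice chart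
   (U, phi), whose chart on M `&` U is slice_coord m \o phi.  The ideal of M is
   taken in the atlas of all these charts; it does not depend on the atlas. *)
Definition manifold_ideal (R : realType) (I : forall m : nat, set (set 'rV[R]_m))
    (m N : nat) (M : set 'rV[R]_N) : set (set 'rV[R]_N) :=
  [set A | A `<=` M /\
    forall U phi, slice_chart m M U phi ->
      I m ((fun z => slice_coord m (phi z)) @` (A `&` U))].

Definition bot (R : realType) (n : nat) (ip : {dot 'rV[R]_n for @idfun R})
    : set 'rV[R]_(n + n) :=
  [set z | ip (lsubmx z) (rsubmx z) = 0].

Definition bot_star (R : realType) (n : nat)
    (ip : {dot 'rV[R]_n for @idfun R}) : set 'rV[R]_(n + n) :=
  bot ip `\ 0.

(* bot_star ip has dimension 2n - 1 and sits in R^(2n) = R^n x R^n. *)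
Definition bot_ideal (R : realType) (I : forall m : nat, set (set 'rV[R]_m))
    (n : nat) (ip : {dot 'rV[R]_n for @idfun R}) : set (set 'rV[R]_(n + n)) :=
  manifold_ideal I (n + n).-1 (bot_star ip).

Definition orthogonally_additive (R : realType) (n : nat)
    (ip : {dot 'rV[R]_n for @idfun R}) (G : zmodType) (g : 'rV[R]_n -> G)
    : Prop :=
  forall x y : 'rV[R]_n, bot ip (row_mx x y) -> g (x + y) = g x + g y.

(* Main.v *)
From HB Require Import structures.
Require Import Defs.
From mathcomp Require Import all_boot all_order all_algebra.
From mathcomp Require Import all_classical all_reals all_analysis.
From mathcomp Require Import ring.
Set Implicit Arguments.
Unset Strict Implicit.
Unset Printing Implicit Defensive.
Import Order.TTheory GRing.Theory Num.Theory.
Import numFieldNormedType.Exports.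
Import VectorInternalTheory.
Local Open Scope classical_set_scope.
Local Open Scope ring_scope.

(** Write [<x|y>] for the inner product and [C(x, y) = f(x + y) - f(x) - f(y)].
    If [f] were orthogonally additive everywhere, it would have the form
    [f(x) = m(<x|x>/2) + b(x)] with [m] and [b] additive, and then
    [C(x, y) = m(<x|y>)].  The proof recovers [m] and [b] from [C].

    Decompose [y = s x + z] with [z] orthogonal to [x].  Additivity at the
    orthogonal pairs [(s x, z)] and [((s + 1) x, z)] gives
    [f(x + y) - f(y) = f((s + 1) x) - f(s x)], so that [C(x, y) = D(x, <x|y>)]
    for an explicit function [D] ([cauchy_diff_line]).  As [C] is symmetric,
    [D(x, s) = D(y, s)] with [s = <x|y>].  A displacement [w] of [x] orthogonal
    to [y] keeps [<x|y>], hence [D(x, s) = D(y, s) = D(x + w, s)]; in dimension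
    at least 2 the triple [(x, w, s)] obtained in this way is generic
    ([line_diff_shift]).  Therefore [D(x, s) = c(s)], and [C(x, y) = c(<x|y>)]
    almost everywhere.  For orthogonal [x] and [z], where [C(x, z) = 0], the
    cocycle identity of [C] becomes the additivity of [c]
    ([cauchy_diff_additive]).  An almost everywhere additive function agrees
    almost everywhere with an additive one ([almost_additive], the argument of
    de Bruijn): applied to [c] it gives [m], and applied to
    [x |-> f(x) - m(<x|x>/2)] it gives [b] ([ortho_extension]).

    For uniqueness, let [h] be the difference of two solutions.  It is
    orthogonally additive and vanishes almost everywhere, and its alternating
    sum over the vertices of any rectangle is 0 ([ortho_rectangle]).  Every
    point [v] is a vertex of a rectangle whose three other vertices are
    generic, so [h(v) = 0] ([ortho_unique]).

    A set all of whose sections are null need not be null: the axioms give only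
    one half of Fubini's theorem.  Hence every statement about almost all
    points is obtained from another one by pulling it back along a
    diffeomorphism or a surjective linear map, and is weakened by discarding
    variables.  The pairs [(x, z)] with [z] orthogonal to [x] are parametrized
    by [(x, t) |-> (x, oproj x t)], where [oproj x t] is the point of the line
    [t + R e] that is orthogonal to [x], for a fixed vector [e].  The parameter
    [t] ranges over the whole space, so that one of its coordinates is
    redundant; in exchange all the parameter spaces are products of copies of
    [R^n] and [R], and the changes of variables are affine in one block of
    coordinates ([pullback_ae_affine]), except for [swap], which exchanges the
    two members of an orthogonal pair. *)

(** * Functions of class C^k on an open set *)

Section Ck.
Context (R : realType).
Implicit Types (V W : normedModType R).

(** The differential is local.  This is what makes [Ck_on] insensitive to the
    values outside an open set, and the rules below need it: a differentiation
    rule holds only at the points of [U], whereas [Ck_on] speaks of the total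
    function [x |-> 'd f x v]. *)
Lemma near_eq_diff V W (f g : V -> W) x : (\near x, f x = g x) ->
  differentiable f x -> differentiable g x /\ 'd g x = 'd f x :> (V -> W).
Proof.
move=> fg df; have [dc de] := (diff_locallyP x f).1 df.
have fgx : f x = g x by exact: nbhs_singleton fg.
have eg : g \o shift x = cst (g x) + 'd f x +o_ 0 id.
  apply/eqaddoP => e e0; rewrite -fgx.
  have := (eqaddoP _ _ _ _ ).1 de e e0.
  have : \forall y \near 0, f (y + x) = g (y + x).
    by have := fg; rewrite (near_shift 0) subr0.
  by apply: filterS2 => y /= E; rewrite !fctE /= E.
have E : 'd g x = 'd f x :> (V -> W) by exact: diff_unique.
split; last exact: E.
apply: (diff_locallyP x g).2; rewrite E; split; [exact: dc|exact: eg].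
Qed.

Lemma open_near V (U : set V) (P : V -> Prop) x : open U -> U x ->
  (forall y, U y -> P y) -> \near x, P x.
Proof.
move=> oU Ux H; have := open_nbhs_nbhs (conj oU Ux).
by apply: filterS => y; apply: H.
Qed.

Lemma Ck_eq V W k (U : set V) (f g : V -> W) : open U ->
  (forall x, U x -> f x = g x) -> Ck_on k U f -> Ck_on k U g.
Proof.
move=> oU; elim: k f g => [|k IH] f g fg /= Hf.
  move=> x Ux.
  have := Hf x Ux; rewrite /prop_for /continuous_at => Hx.
  rewrite -(fg x Ux); apply: cvg_trans Hx.
  by apply: near_eq_cvg; apply: (open_near oU Ux) => y /fg ->.
have L x (Ux : U x) := near_eq_diff (open_near oU Ux fg) (Hf.1 x Ux).
split=> [x Ux|v]; first by have [] := L x Ux.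
apply: IH (Hf.2 v) => x Ux.
exact: (esym (congr1 (@^~ v) (L x Ux).2)).
Qed.

Lemma Ck_continuous V W k (U : set V) (f : V -> W) : Ck_on k U f ->
  forall x, U x -> {for x, continuous f}.
Proof.
case: k => [//|k] /= [df _] x Ux.
exact/differentiable_continuous/df.
Qed.

Lemma CkW V W k (U : set V) (f : V -> W) : Ck_on k.+1 U f -> Ck_on k U f.
Proof.
elim: k f => [|k IH] f; first exact: Ck_continuous.
by move=> /= [df H]; split=> // v; apply: IH (H v).
Qed.

Lemma Ck_cst V W k (U : set V) (a : W) : Ck_on k U (cst a : V -> W).
Proof.
elim: k a => [|k IH] a /=; first by move=> x _; exact: cst_continuous.
split=> [x _|v]; first exact: differentiable_cst.
have -> : (fun x => 'd (cst a : V -> W) x v) = cst 0; last exact: IH.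
by apply/funext => x; rewrite diff_cst.
Qed.

Lemma CkD V W k (U : set V) (f g : V -> W) : open U ->
  Ck_on k U f -> Ck_on k U g -> Ck_on k U (fun x => f x + g x).
Proof.
move=> oU; elim: k f g => [|k IH] f g /=.
  by move=> cf cg x Ux; apply: cvgD; [apply: cf|apply: cg].
move=> [df Hf] [dg Hg]; split=> [x Ux|v].
  exact: differentiableD (df x Ux) (dg x Ux).
apply: Ck_eq (IH _ _ (Hf v) (Hg v)) => // x Ux.
exact: (esym (congr1 (@^~ v) (diffD (df x Ux) (dg x Ux)))).
Qed.

Lemma CkM V k (U : set V) (f g : V -> R) : open U ->
  Ck_on (W := R) k U f -> Ck_on (W := R) k U g ->
  Ck_on (W := R) k U (fun x => f x * g x).
Proof.
move=> oU; elim: k f g => [|k IH] f g.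
  by move=> cf cg x Ux; apply: cvgM; [apply: cf|apply: cg].
move=> Hf Hg; have [df H1] := Hf; have [dg H2] := Hg; split=> [x Ux|v].
  exact: differentiableM (df x Ux) (dg x Ux).
have := CkD oU (IH _ _ (CkW Hf) (H2 v)) (IH _ _ (CkW Hg) (H1 v)).
apply: Ck_eq => // x Ux.
exact: (esym (congr1 (@^~ v) (diffM (df x Ux) (dg x Ux)))).
Qed.

Lemma CkV V k (U : set V) (f : V -> R) : open U ->
  (forall x, U x -> f x != 0) ->
  Ck_on (W := R) k U f -> Ck_on (W := R) k U (fun x => (f x)^-1).
Proof.
move=> oU f0; elim: k => [|k IH].
  by move=> cf x Ux; apply: cvgV; [apply: f0|apply: cf].
move=> Hf; have [df H1] := Hf; split=> [x Ux|v].
  exact: differentiableV (df x Ux) (f0 x Ux).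
have If := IH (CkW Hf).
have := CkM oU (Ck_cst k U (-1 : R)) (CkM oU (CkM oU If If) (H1 v)).
apply: Ck_eq => // x Ux.
rewrite [RHS](congr1 (@^~ v) (diffV (df x Ux) (f0 x Ux))) /=.
by rewrite mulN1r -exprVn; exact: esym (mulNr _ _).
Qed.

Lemma CkZl V W k (U : set V) (f : V -> R) (w : W) : open U ->
  Ck_on (W := R) k U f -> Ck_on k U (fun x => f x *: w).
Proof.
move=> oU; elim: k f => [|k IH] f.
  by move=> cf x Ux; apply: cvgZr_tmp; apply: cf.
move=> [df H]; split=> [x Ux|v]; first exact: differentiableZl (df x Ux).
apply: Ck_eq (IH _ (H v)) => // x Ux.
exact: (esym (congr1 (@^~ v) (diffZl w (df x Ux)))).
Qed.

Lemma Ck_sum V W k (U : set V) m (f : 'I_m -> V -> W) : open U ->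
  (forall i, Ck_on k U (f i)) -> Ck_on k U (fun x => \sum_i f i x).
Proof.
move=> oU; elim: m f => [|m IH] f H.
  by apply: Ck_eq (Ck_cst k U 0) => // x _; rewrite big_ord0.
have Hm := IH (fun i => f (widen_ord (leqnSn m) i)) (fun i => H _).
apply: Ck_eq (CkD oU Hm (H ord_max)) => //.
by move=> x _; rewrite big_ord_recr.
Qed.

Lemma Ck_coord m k (U : set 'rV[R]_m) i :
  Ck_on (W := R) k U (fun x : 'rV[R]_m => x 0 i).
Proof.
have @l : {linear 'rV[R]_m -> R}.
  by exists (fun x : 'rV[R]_m => x 0 i); do 2![eexists]; do ?[constructor];
     rewrite ?mxE// => ? *; rewrite ?mxE//; move=> ?; rewrite !mxE.
have cl : continuous l by exact: coord_continuous.
suff : Ck_on (W := R) k U l by [].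
case: k => [|k]; first by move=> x _; apply: cl.
split=> [x _|v]; first exact: (@linear_differentiable _ _ _ l).
suff -> : (fun x => 'd l x v) = cst (l v) by apply: Ck_cst.
by apply/funext => x; rewrite (@diff_lin _ _ _ l).
Qed.

Lemma Ck_sub V W k (U U' : set V) (f : V -> W) : U' `<=` U ->
  Ck_on k U f -> Ck_on k U' f.
Proof.
move=> UU'; elim: k f => [|k IH] f /=; first by move=> H x /UU'; apply: H.
by move=> [df H]; split=> [x /UU'|v]; [apply: df|apply: IH (H v)].
Qed.

End Ck.

(** * Smooth maps between finite dimensional spaces *)

Section Smooth.
Context (R : realType).
Implicit Types (V W : vectType R).

(** Openness and smoothness in [V] are read through all the linear maps from the
    spaces [R^m] to [V].  This gives them a meaning on every product of spaces,
    and makes them stable under precomposition by linear maps. *)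
Definition lin_open V (D : set V) :=
  forall m (L : 'rV[R]_m -> V), linear L -> open (L @^-1` D).

Definition smooth_fun V (D : set V) (f : V -> R) :=
  lin_open D /\ forall m (L : 'rV[R]_m -> V), linear L ->
    forall k, Ck_on (W := R) k (L @^-1` D) (f \o L).

Definition smooth_map V W (D : set V) (F : V -> W) :=
  forall l : W -> R^o, linear l -> smooth_fun D (l \o F).

Lemma lin_openT V : lin_open (@setT V).
Proof. by move=> m L _; rewrite preimage_setT; exact: openT. Qed.

Lemma lin_openI V (D D' : set V) :
  lin_open D -> lin_open D' -> lin_open (D `&` D').
Proof. by move=> oD oD' m L lL; rewrite preimage_setI; apply: openI; auto. Qed.

Lemma lin_open_preim V W (D : set W) (K : V -> W) : linear K -> lin_open D ->
  lin_open (K @^-1` D).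
Proof.
move=> lK oD m L lL; rewrite -comp_preimage; apply: oD.
by move=> a u v /=; rewrite lL lK.
Qed.

Lemma lin_open_neq0 V (D : set V) (f : V -> R) : smooth_fun D f ->
  lin_open [set v | D v /\ f v != 0].
Proof.
move=> [oD Hf] m L lL; rewrite openE => x /= [Dx fx].
have cf := Hf m L lL 0%N x Dx.
rewrite /interior; near=> y; split; near: y.
  by apply: open_nbhs_nbhs; split; [exact: oD|].
exact: (cvgr_neq0 _ cf fx).
Unshelve. all: by end_near. Qed.

Lemma smooth_fun_open V (D : set V) f : smooth_fun D f -> lin_open D.
Proof. by case. Qed.

Lemma smooth_fun_sub V (D D' : set V) f : lin_open D' -> D' `<=` D ->
  smooth_fun D f -> smooth_fun D' f.
Proof.
move=> oD' DD' [_ H]; split=> // m L lL k.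
by apply: Ck_sub (H m L lL k) => x; apply: DD'.
Qed.

Lemma smooth_fun_ext V (D : set V) f g : (forall v, D v -> f v = g v) ->
  smooth_fun D f -> smooth_fun D g.
Proof.
move=> fg [oD H]; split=> // m L lL k.
by apply: Ck_eq (H m L lL k) => [|x]; [exact: oD|apply: fg].
Qed.

Lemma smooth_fun_cst V (D : set V) (a : R) : lin_open D -> smooth_fun D (fun=> a).
Proof. by move=> oD; split=> // m L lL k; exact: Ck_cst. Qed.

Lemma smooth_funD V (D : set V) f g : smooth_fun D f -> smooth_fun D g ->
  smooth_fun D (fun v => f v + g v).
Proof.
move=> [oD Hf] [_ Hg]; split=> // m L lL k.
by apply: (@CkD R _ R); [exact: oD|exact: Hf|exact: Hg].
Qed.

Lemma smooth_funM V (D : set V) f g : smooth_fun D f -> smooth_fun D g ->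
  smooth_fun D (fun v => f v * g v).
Proof.
move=> [oD Hf] [_ Hg]; split=> // m L lL k.
by apply: (@CkM R); [exact: oD|exact: Hf|exact: Hg].
Qed.

Lemma smooth_funN V (D : set V) f : smooth_fun D f -> smooth_fun D (fun v => - f v).
Proof.
move=> Hf; have Hc := smooth_fun_cst (-1) (smooth_fun_open Hf).
apply: smooth_fun_ext (smooth_funM Hc Hf) => v _.
by rewrite mulN1r.
Qed.

Lemma smooth_funV V (D : set V) f : (forall v, D v -> f v != 0) -> smooth_fun D f ->
  smooth_fun D (fun v => (f v)^-1).
Proof.
move=> f0 [oD Hf]; split=> // m L lL k.
by apply: (@CkV R); [exact: oD|move=> x; apply: f0|exact: Hf].
Qed.

Lemma smooth_fun_sum V (D : set V) m (f : 'I_m -> V -> R) : lin_open D ->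
  (forall i, smooth_fun D (f i)) -> smooth_fun D (fun v => \sum_i f i v).
Proof.
move=> oD H; split=> // p L lL k.
by apply: (@Ck_sum R _ R); [exact: oD|move=> i; exact: (H i).2].
Qed.

Lemma linear_sumE V W (K : V -> W) : linear K ->
  forall m (a : 'I_m -> R) (b : 'I_m -> V),
  K (\sum_i a i *: b i) = \sum_i a i *: K (b i).
Proof.
move=> lK m a b; pose KL : {linear V -> W} :=
  HB.pack K (GRing.isLinear.Build _ _ _ _ _ lK).
rewrite -[K]/(KL : V -> W) linear_sum; apply: eq_bigr => i _.
by rewrite linearZ.
Qed.

Lemma smooth_fun_lin V (D : set V) (l : V -> R^o) : lin_open D -> linear l ->
  smooth_fun D l.
Proof.
move=> oD ll; split=> // m L lL k.
have llL : linear (l \o L) by move=> a u v /=; rewrite lL ll.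
apply: (@Ck_eq R _ R _ _ (fun x : 'rV_m => \sum_i x 0 i * (l \o L) (delta_mx 0 i))).
- exact: oD.
- by move=> x _; rewrite [in RHS](row_sum_delta x) (linear_sumE llL).
apply: (@Ck_sum R _ R) => [|i]; first exact: oD.
apply: CkM; [exact: oD|exact: Ck_coord|exact: (@Ck_cst R _ R)].
Qed.

Lemma smooth_fun_preim V W (D : set W) (K : V -> W) f : linear K -> smooth_fun D f ->
  smooth_fun (K @^-1` D) (f \o K).
Proof.
move=> lK [oD Hf]; split; first exact: lin_open_preim.
move=> m L lL k; have lKL : linear (K \o L) by move=> a u v /=; rewrite lL lK.
exact: (Hf m _ lKL k).
Qed.

Lemma smooth_map_lin V W (D : set V) (F : V -> W) : lin_open D -> linear F ->
  smooth_map D F.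
Proof.
by move=> oD lF l ll; apply: smooth_fun_lin => // a u v /=; rewrite lF ll.
Qed.

Lemma smooth_map_comp V W W' (D : set V) (F : V -> W) (K : W -> W') :
  linear K -> smooth_map D F -> smooth_map D (K \o F).
Proof.
move=> lK H l ll; apply: (H (l \o K)) => a u v /=; by rewrite lK ll.
Qed.

Lemma smooth_mapD V W (D : set V) (F G : V -> W) : smooth_map D F -> smooth_map D G ->
  smooth_map D (fun v => F v + G v).
Proof.
move=> HF HG l ll; apply: smooth_fun_ext (smooth_funD (HF l ll) (HG l ll)) => v _ /=.
by rewrite -[F v]scale1r ll scale1r [RHS]/( 1%R *: l _ + l _) scale1r.
Qed.

Lemma smooth_mapZ V W (D : set V) f (F : V -> W) : smooth_fun D f -> smooth_map D F ->
  smooth_map D (fun v => f v *: F v).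
Proof.
move=> Hf HF l ll; apply: smooth_fun_ext (smooth_funM Hf (HF l ll)) => v _ /=.
pose lL : {linear W -> R^o} := HB.pack l (GRing.isLinear.Build _ _ _ _ _ ll).
by rewrite -[l]/(lL : W -> R^o) linearZ.
Qed.

Lemma smooth_map_cst V W (D : set V) (w : W) : lin_open D -> smooth_map D (fun=> w).
Proof. by move=> oD l ll; exact: smooth_fun_cst. Qed.

Lemma smooth_map_fst V W W' (D : set V) (F : V -> W * W') : smooth_map D F ->
  smooth_map D (fun v => (F v).1).
Proof. by apply: (smooth_map_comp (K := fst)) => a [? ?] [? ?]. Qed.

Lemma smooth_map_snd V W W' (D : set V) (F : V -> W * W') : smooth_map D F ->
  smooth_map D (fun v => (F v).2).
Proof. by apply: (smooth_map_comp (K := snd)) => a [? ?] [? ?]. Qed.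

Lemma smooth_map_of_fun V (D : set V) (f : V -> R) :
  smooth_fun D f -> smooth_map D (f : V -> R^o).
Proof.
move=> Hf; have := smooth_mapZ Hf (smooth_map_cst (1 : R^o) (smooth_fun_open Hf)).
rewrite /smooth_map => H l /H; apply: smooth_fun_ext => v _ /=.
by congr l; exact: mulr1.
Qed.

Lemma smooth_fun_of_map V (D : set V) (f : V -> R^o) : smooth_map D f -> smooth_fun D f.
Proof. by move=> H; apply: (H id). Qed.

Lemma smooth_map_pair V W W' (D : set V) (F : V -> W) (G : V -> W') :
  smooth_map D F -> smooth_map D G -> smooth_map D (fun v => (F v, G v)).
Proof.
move=> HF HG.
have H1 : smooth_map D (fun v => (F v, 0 : W')).
  apply: (smooth_map_comp (K := fun w => (w, 0))) HF => a u v.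
  by congr pair; rewrite [RHS](_ : _ = a *: 0 + 0) // scaler0 addr0.
have H2 : smooth_map D (fun v => (0 : W, G v)).
  apply: (smooth_map_comp (K := fun w => (0, w))) HG => a u v.
  by congr pair; rewrite [RHS](_ : _ = a *: 0 + 0) // scaler0 addr0.
have := smooth_mapD H1 H2; rewrite /smooth_map => H l /H.
apply: smooth_fun_ext => v _ /=.
by congr l; congr pair; rewrite ?addr0 ?add0r.
Qed.

Lemma smooth_fun_bilin V W W' (D : set V) (B : W -> W' -> R^o)
    (F : V -> W) (G : V -> W') :
  (forall w, linear (B w)) -> (forall w', linear (B ^~ w')) -> lin_open D ->
  smooth_map D F -> smooth_map D G -> smooth_fun D (fun v => B (F v) (G v)).
Proof.
move=> Br Bl oD HF HG.
pose e (i : 'I_(dim W')) : W' := r2v (delta_mx 0 i).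
have cl i : linear (fun w : W' => v2r w 0 i : R^o).
  by move=> a u v; rewrite linearP !mxE.
apply: (@smooth_fun_ext _ _ (fun v => \sum_i v2r (G v) 0 i * B (F v) (e i))).
  move=> v _; rewrite -[in RHS](v2rK (G v)) [in RHS](row_sum_delta (v2r (G v))).
  rewrite linear_sum /= -(linear_sumE (Br (F v))); congr B.
  by apply: eq_bigr => i _; rewrite linearZ.
apply: smooth_fun_sum => // i; apply: smooth_funM; first exact: HG (cl i).
exact: HF (Bl (e i)).
Qed.

Lemma smooth_map_preim V V' W (D : set V) (K : V' -> V) (F : V -> W) :
  linear K -> smooth_map D F -> smooth_map (K @^-1` D) (F \o K).
Proof. by move=> lK H l ll; exact: (smooth_fun_preim lK (H l ll)). Qed.

Lemma smooth_map_rV m p (D : set 'rV[R]_m) (F : 'rV[R]_m -> 'rV[R]_p) :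
  smooth_map D F -> smooth_on D F.
Proof.
move=> HF k; have lc j : linear (fun w : 'rV[R]_p => w 0 j : R^o).
  by move=> a u v; rewrite !mxE.
have [oD _] : smooth_fun D ((fun=> 0) \o F).
  by apply: (HF (fun=> 0)) => a u v; rewrite scaler0 addr0.
have oD1 : open D by apply: (oD m id).
apply: (@Ck_eq _ _ _ _ _ (fun x => \sum_i F x 0 i *: delta_mx 0 i)) => //.
  by move=> x _; rewrite -row_sum_delta.
apply: Ck_sum => // i; apply: CkZl => //.
by have [_ /(_ m id)] := HF _ (lc i); apply.
Qed.

Lemma smooth_map_smooth_on V W (D : set V) (F : V -> W) : smooth_map D F ->
  smooth_on ((r2v : 'rV[R]_(dim V) -> V) @^-1` D)
    (v2r \o F \o r2v : 'rV[R]_(dim V) -> 'rV[R]_(dim W)).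
Proof.
move=> HF; apply: smooth_map_rV.
have lr : linear (r2v : 'rV[R]_(dim V) -> V) by exact: linearP.
have lv : linear (v2r : W -> 'rV[R]_(dim W)) by exact: linearP.
exact: (smooth_map_comp lv (smooth_map_preim lr HF)).
Qed.

End Smooth.

(** * Null sets in finite dimensional spaces *)

Section Ae.
Context (R : realType) (I : forall m : nat, set (set 'rV[R]_m)).
Hypothesis hI : ideal_system I.
Implicit Types (V W Z : vectType R).

Lemma linear_cancel V W (F : V -> W) (G : W -> V) :
  linear F -> cancel F G -> cancel G F -> linear G.
Proof.
by move=> lF FK GK a u v; rewrite -[in LHS](GK u) -[in LHS](GK v) -lF FK.
Qed.

(** Dimensions of products are often equal without being convertible; a linear
    bijection provides the equality. *)
Lemma linear_bij_dim m m' (F : 'rV[R]_m -> 'rV[R]_m') (G : 'rV[R]_m' -> 'rV[R]_m) :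
  linear F -> cancel F G -> cancel G F -> m = m'.
Proof.
move=> lF FK GK; have lG := linear_cancel lF FK GK.
pose FL : {linear 'rV[R]_m -> 'rV[R]_m'} :=
  HB.pack F (GRing.isLinear.Build _ _ _ _ _ lF).
pose GL : {linear 'rV[R]_m' -> 'rV[R]_m} :=
  HB.pack G (GRing.isLinear.Build _ _ _ _ _ lG).
apply/eqP; rewrite eqn_leq; apply/andP; split.
  apply: (@mulmx1_min _ _ _ (lin1_mx FL) (lin1_mx GL)).
  by apply/row_matrixP => i; rewrite !rowE mulmxA !mul_rV_lin1 mulmx1 /= FK.
apply: (@mulmx1_min _ _ _ (lin1_mx GL) (lin1_mx FL)).
by apply/row_matrixP => i; rewrite !rowE mulmxA !mul_rV_lin1 mulmx1 /= GK.
Qed.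

(** The invariance of the ideals under diffeomorphisms, applied to the inverse
    [psi], in the form of inverse images. *)
Lemma ideal_diffeo m (D D' : set 'rV[R]_m) (phi psi : 'rV[R]_m -> 'rV[R]_m)
    (A : set 'rV[R]_m) :
  (0 < m)%N -> open D -> open D' -> smooth_on D phi -> smooth_on D' psi ->
  (forall x, D x -> D' (phi x)) -> (forall y, D' y -> D (psi y)) ->
  (forall x, D x -> psi (phi x) = x) -> (forall y, D' y -> phi (psi y) = y) ->
  I A -> I (D `&` phi @^-1` A).
Proof.
move=> m0 oD oD' sphi spsi DD' D'D K K' IA.
have E : psi @` D' = D.
  rewrite predeqE => x; split=> [[y Dy <-]|Dx]; first exact: D'D.
  by exists (phi x); [exact: DD'|exact: K].
have dp : diffeo_on D' psi.
  by split; rewrite ?E //; exists phi; rewrite ?E.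
have := ideal_H1 hI m0 dp IA; congr (I _).
rewrite predeqE => x; split=> [[y [Ay Dy] <-]|[Dx Ax]].
  by split; [exact: D'D|rewrite /preimage /= K'].
by exists (phi x); [split=> //; exact: DD'|exact: K].
Qed.

Lemma ideal_subset m (A B : set 'rV[R]_m) : (0 < m)%N -> I A -> B `<=` A -> I B.
Proof. by move=> m0; have [_ H _] := ideal_proper hI m0; exact: H. Qed.

Lemma ideal_linear m m' (F : 'rV[R]_m -> 'rV[R]_m') (G : 'rV[R]_m' -> 'rV[R]_m)
    (A : set 'rV[R]_m') : (0 < m)%N ->
  linear F -> cancel F G -> cancel G F -> I A -> I (F @^-1` A).
Proof.
move=> m0 lF FK GK; have mm' := linear_bij_dim lF FK GK; subst m'.
have lG := linear_cancel lF FK GK => IA.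
have sm (K : 'rV[R]_m -> 'rV[R]_m) : linear K -> smooth_on setT K.
  by move=> lK; apply: smooth_map_rV; apply: smooth_map_lin => //; exact: lin_openT.
have := ideal_diffeo m0 openT openT (sm F lF) (sm G lG) _ _ _ _ IA.
by rewrite setTI; apply.
Qed.

(** The ideals are carried to a space [V] by the coordinates [r2v]; by
    [ideal_linear] any other linear coordinates give the same notion. *)
Definition ae V (P : V -> Prop) : Prop := I [set x : 'rV[R]_(dim V) | ~ P (r2v x)].

Lemma aeW V (P Q : V -> Prop) : (0 < dim V)%N -> (forall v, P v -> Q v) ->
  ae P -> ae Q.
Proof.
by move=> V0 PQ H; apply: (ideal_subset V0 H) => x /= nQ Px; apply/nQ/PQ.
Qed.

Lemma ae_and V (P Q : V -> Prop) : (0 < dim V)%N -> ae P -> ae Q ->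
  ae (fun v => P v /\ Q v).
Proof.
move=> V0 HP HQ; have [_ _ U] := ideal_proper hI V0.
pose A k := if k is 0%N then [set x : 'rV[R]_(dim V) | ~ P (r2v x)]
  else [set x | ~ Q (r2v x)].
have HA k : I (A k) by case: k.
apply: (ideal_subset V0 (U A HA)) => x /= nPQ.
have [Px|nP] := pselect (P (r2v x)); last by exists 0%N.
by exists 1%N => //= Qx; apply: nPQ.
Qed.

Lemma ae_ex V (P : V -> Prop) : (0 < dim V)%N -> ae P -> exists v, P v.
Proof.
move=> V0 H; have [nT _ _] := ideal_proper hI V0.
apply: contrapT => nP; apply: nT; apply: (ideal_subset V0 H) => x _ /= Px.
by apply: nP; exists (r2v x).
Qed.

Lemma ae_linear_bij V W (F : V -> W) (G : W -> V) (P : W -> Prop) :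
  (0 < dim V)%N -> linear F -> cancel F G -> cancel G F ->
  ae P -> ae (P \o F).
Proof.
move=> V0 lF FK GK HP.
pose F' (x : 'rV[R]_(dim V)) : 'rV[R]_(dim W) := v2r (F (r2v x)).
pose G' (x : 'rV[R]_(dim W)) : 'rV[R]_(dim V) := v2r (G (r2v x)).
have lF' : linear F' by move=> a u v; rewrite /F' linearP lF linearP.
have F'K : cancel F' G' by move=> x; rewrite /F' /G' v2rK FK r2vK.
have G'K : cancel G' F' by move=> x; rewrite /F' /G' v2rK GK r2vK.
have := ideal_linear V0 lF' F'K G'K HP.
by move=> /(ideal_subset V0); apply => x /=; rewrite /F' v2rK.
Qed.

Lemma ae_diffeo V (D D' : set V) (phi psi : V -> V) (P : V -> Prop) :
  (0 < dim V)%N -> lin_open D -> lin_open D' -> smooth_map D phi -> smooth_map D' psi ->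
  (forall x, D x -> D' (phi x)) -> (forall y, D' y -> D (psi y)) ->
  (forall x, D x -> psi (phi x) = x) -> (forall y, D' y -> phi (psi y) = y) ->
  ae P -> ae (fun v => D v -> P (phi v)).
Proof.
move=> V0 oD oD' sphi spsi DD' D'D K K' HP.
have lr : linear (r2v : 'rV[R]_(dim V) -> V) by exact: linearP.
have := ideal_diffeo V0 (oD _ _ lr) (oD' _ _ lr) (smooth_map_smooth_on sphi)
  (smooth_map_smooth_on spsi) _ _ _ _ HP.
move=> H; apply: (ideal_subset V0 (H _ _ _ _)).
- by move=> x /= Dx; rewrite v2rK; exact: DD'.
- by move=> x /= Dx; rewrite v2rK; exact: D'D.
- by move=> x /= Dx; rewrite v2rK K ?r2vK.
- by move=> x /= Dx; rewrite v2rK K' ?r2vK.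
by move=> x /= /not_implyP [Dx nP]; split=> //; rewrite /preimage /= v2rK.
Qed.

(** The coordinates of a pair are not the concatenation of the coordinates of
    its components; the two systems of coordinates differ by a linear
    bijection. *)
Lemma ae_pairE V W (P : V * W -> Prop) : (0 < dim V)%N -> (0 < dim W)%N ->
  ae P <-> I [set z : 'rV[R]_(dim V + dim W) | ~ P (r2v (lsubmx z), r2v (rsubmx z))].
Proof.
move=> V0 W0.
pose F (z : 'rV[R]_(dim V + dim W)) : 'rV[R]_(dim (V * W)%type) :=
  v2r ((r2v (lsubmx z), r2v (rsubmx z)) : V * W).
pose G (z : 'rV[R]_(dim (V * W)%type)) : 'rV[R]_(dim V + dim W) :=
  let p := (r2v z : V * W) in row_mx (v2r p.1) (v2r p.2).
have lF : linear F.
  move=> a u v; rewrite /F -linearP; congr (v2r _).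
  by congr pair; rewrite linearP [LHS]linearP.
have FK : cancel F G by move=> z; rewrite /F /G v2rK /= !r2vK hsubmxK.
have GK : cancel G F.
  by move=> z; rewrite /F /G row_mxKl row_mxKr !v2rK -surjective_pairing r2vK.
have lG : linear G := linear_cancel lF FK GK.
have VW0 : (0 < dim V + dim W)%N by rewrite addn_gt0 V0.
split=> H.
  have := ideal_linear VW0 lF FK GK H; move=> /(ideal_subset VW0); apply => z /=.
  by rewrite /F v2rK.
have H' := ideal_linear VW0 lG GK FK H.
apply: (ideal_subset _ H') => [//|z /=].
by rewrite /G row_mxKl row_mxKr !v2rK -surjective_pairing.
Qed.

Lemma ae_fubini V W (P : V * W -> Prop) : (0 < dim V)%N -> (0 < dim W)%N ->
  ae P -> ae (fun v => ae (fun w => P (v, w))).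
Proof.
move=> V0 W0 /(ae_pairE _ V0 W0) H.
have := ideal_H2 hI V0 W0 H; move=> /(ideal_subset V0); apply => x /= nP HP.
apply: nP; move: HP => /(ideal_subset W0); apply => y /=.
by rewrite row_mxKl row_mxKr.
Qed.

Lemma ae_snd V W (P : W -> Prop) : (0 < dim V)%N -> (0 < dim W)%N ->
  ae P -> ae (fun p : V * W => P p.2).
Proof. by move=> V0 W0 H; apply/ae_pairE => //; exact: (ideal_H3 hI V0 W0 H). Qed.

End Ae.

Lemma dim_pair_gt0 (R : realType) (V W : vectType R) :
  (0 < dim (V * W)%type)%N = (0 < dim V)%N || (0 < dim W)%N.
Proof. by rewrite -addn_gt0. Qed.

Lemma dim_regular_gt0 (R : realType) : (0 < dim (R^o : vectType R))%N.
Proof. by []. Qed.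

Ltac dim_pos := by rewrite !(dim_pair_gt0, dim_regular_gt0) //;
  repeat match goal with
  | H : is_true (0 < dim _)%N |- _ => rewrite ?H ?orbT; clear H
  end.

(** * Pulling back statements about almost all points *)

Section Pullback.
Context (R : realType) (I : forall m : nat, set (set 'rV[R]_m)).
Hypothesis hI : ideal_system I.
Implicit Types (V W Z : vectType R).
Local Notation ae := (ae I).

Lemma ae_translate V (v0 : V) (P : V -> Prop) : (0 < dim V)%N ->
  ae P -> ae (fun v => P (v + v0)).
Proof.
move=> V0 HP.
have tr (w : V) : smooth_map setT (fun v : V => v + w).
  apply: smooth_mapD; last by apply: smooth_map_cst; exact: lin_openT.
  by apply: (smooth_map_lin (F := id)); first exact: lin_openT.
have := ae_diffeo hI V0 (@lin_openT R V) (@lin_openT R V) (tr v0) (tr (- v0))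
  _ _ _ _ HP.
move=> H; apply: (aeW hI V0 _ (H _ _ _ _)) => //.
- by move=> v; apply.
- by move=> v _; rewrite addrK.
- by move=> v _; rewrite subrK.
Qed.

(** The map [(w, v) |-> (v, w + L v)] is a linear bijection, so that for almost
    every [w] the statement holds at [w + L v] for almost every [v].  One such
    [w] suffices: it is [L v0] for some [v0], and a translation by [v0]
    concludes. *)
Lemma ae_linear V W (L : V -> W) (P : W -> Prop) :
  (0 < dim V)%N -> (0 < dim W)%N -> linear L -> (forall w, exists v, L v = w) ->
  ae P -> ae (fun v => P (L v)).
Proof.
move=> V0 W0 lL sL HP.
have LD v w : L (v + w) = L v + L w by have := lL 1 v w; rewrite !scale1r.
pose F (p : W * V) : V * W := (p.2, p.1 + L p.2).
pose G (p : V * W) : W * V := (p.2 - L p.1, p.1).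
have lF : linear F.
  move=> a [w v] [w' v']; congr pair => /=.
  by rewrite lL [RHS](_ : _ = a *: (w + L v) + (w' + L v')) // scalerDr addrACA.
have := @ae_linear_bij _ _ hI _ _ F G _ _ lF _ _ (ae_snd hI V0 W0 HP).
move=> H; have {}H := ae_fubini hI W0 V0 (H _ _ _).
have WV0 : (0 < dim (W * V)%type)%N by dim_pos.
have [||w0 Hw] := ae_ex hI W0 (H WV0 _ _).
- by move=> [w v]; rewrite /F /G /= addrK.
- by move=> [v w]; rewrite /F /G /= subrK.
have [v0 Lv0] := sL w0.
apply: (aeW hI V0 _ (ae_translate (- v0) V0 Hw)) => v /=.
by rewrite -Lv0 -LD addrC subrK.
Qed.

Lemma ae_fst V W (P : V -> Prop) : (0 < dim V)%N ->
  ae P -> ae (fun p : V * W => P p.1).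
Proof.
move=> V0; apply: (ae_linear (L := fst)) => //; first by dim_pos.
by move=> v; exists (v, 0).
Qed.

Lemma ae_swap V W (P : V * W -> Prop) : (0 < dim V)%N ->
  ae P -> ae (fun p : W * V => P (p.2, p.1)).
Proof.
move=> V0; apply: (ae_linear (L := fun p : W * V => (p.2, p.1))).
- by dim_pos.
- by dim_pos.
- by move=> a [? ?] [? ?].
- by move=> [v w]; exists (w, v).
Qed.

(** The half of Fubini's theorem that is assumed suffices to forget a variable. *)
Lemma ae_drop V W (P : V -> Prop) : (0 < dim V)%N -> (0 < dim W)%N ->
  ae (fun p : V * W => P p.1) -> ae P.
Proof.
move=> V0 W0 /(ae_fubini hI V0 W0); apply: (aeW hI V0) => v /= /(ae_ex hI W0).
by case.
Qed.

(** Adding a redundant displacement along [d], and removing it by fixing a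
    generic value of the displacement.  A map that depends on the variable
    along [d] can so be treated as a function of an independent real variable,
    without choosing a complement of [d]. *)
Lemma ae_direction V (d : V) (P : V -> Prop) : (0 < dim V)%N ->
  ae (fun p : V * R^o => P (p.1 + p.2 *: d)) -> ae P.
Proof.
move=> V0 /(ae_swap V0) /(ae_fubini hI (dim_regular_gt0 R) V0).
move=> /(ae_ex hI (dim_regular_gt0 R)) [r /= H].
have := ae_translate (- (r *: d)) V0 H.
by apply: (aeW hI V0) => v; rewrite subrK.
Qed.

Lemma ae_to_direction V (d : V) (P : V -> Prop) : (0 < dim V)%N ->
  ae P -> ae (fun p : V * R^o => P (p.1 + p.2 *: d)).
Proof.
move=> V0; apply: (ae_linear (L := fun p : V * R^o => p.1 + p.2 *: d)) => //.
- by dim_pos.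
- move=> a [v r] [v' r'].
  rewrite [LHS](_ : _ = (a *: v + v') + (a * r + r') *: d) //=.
  by rewrite scalerDr addrACA scalerDl !scalerA.
- by move=> v; exists (v, 0); rewrite scale0r addr0.
Qed.

Lemma ae_neq0 : ae (fun s : R^o => s != 0).
Proof.
have sub : [set x : 'rV[R]_(dim (R^o : vectType R)) | ~ r2v x != 0] `<=` [set 0].
  move=> x /= /negP; rewrite negbK => /eqP.
  by move=> /(canRL r2vK); rewrite linear0.
exact: (@ideal_subset _ _ hI 1%N _ _ isT (ideal_H0 hI) sub).
Qed.

(** The parameter [Z] makes the property stable under products: a null set of
    [W * Z] cannot be recovered from its sections over [Z]. *)
Definition pullback_ae V W (D : set V) (F : V -> W) : Prop :=
  forall Z (P : W * Z -> Prop), ae P ->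
  ae (fun p : V * Z => D p.1 -> P (F p.1, p.2)).

Lemma pullback_aeE V W (D : set V) (F : V -> W) (P : W -> Prop) :
  (0 < dim V)%N -> (0 < dim W)%N -> pullback_ae D F ->
  ae P -> ae (fun v => D v -> P (F v)).
Proof.
move=> V0 W0 H HP; apply: (@ae_drop V (R^o : vectType R)) => //.
exact: H (@ae_fst W (R^o : vectType R) _ W0 HP).
Qed.

Lemma pullback_ae_comp V W W' (D : set V) (E : set W)
    (F : V -> W) (G : W -> W') :
  pullback_ae D F -> pullback_ae E G ->
  pullback_ae [set v | D v /\ E (F v)] (G \o F).
Proof.
move=> HF HG Z P /HG /HF; rewrite /ae.
congr (I _); apply/seteqP; split=> x /= nH H; apply: nH => ? ; [move=> ?|].
  by apply: H.
by apply: H; intuition.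
Qed.

Lemma pullback_ae_linear V W (F : V -> W) : (0 < dim V)%N -> (0 < dim W)%N ->
  linear F -> (forall w, exists v, F v = w) -> pullback_ae setT F.
Proof.
move=> V0 W0 lF sF Z P HP.
have := @ae_linear (V * Z)%type (W * Z)%type (fun p => (F p.1, p.2)) P.
move=> H; have VZ0 : (0 < dim (V * Z)%type)%N by dim_pos.
apply: (aeW hI VZ0 _ (H _ _ _ _ HP)) => //.
- by dim_pos.
- by move=> a [u z] [u' z'] /=; rewrite lF.
- by move=> [w z]; have [v <-] := sF w; exists (v, z).
Qed.

Lemma pullback_ae_diffeo V (D D' : set V) (phi psi : V -> V) :
  (0 < dim V)%N -> lin_open D -> lin_open D' -> smooth_map D phi -> smooth_map D' psi ->
  (forall x, D x -> D' (phi x)) -> (forall y, D' y -> D (psi y)) ->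
  (forall x, D x -> psi (phi x) = x) -> (forall y, D' y -> phi (psi y) = y) ->
  pullback_ae D phi.
Proof.
move=> V0 oD oD' sphi spsi DD' D'D K K' Z P HP.
have lfst : linear (fst : V * Z -> V) by move=> a [? ?] [? ?].
have ext (E : set V) (F : V -> V) : lin_open E -> smooth_map E F ->
    smooth_map (fst @^-1` E : set (V * Z)) (fun p => (F p.1, p.2)).
  move=> oE HF; apply: smooth_map_pair; first exact: (smooth_map_preim lfst HF).
  apply: (smooth_map_lin (F := snd)); first exact: lin_open_preim.
  by move=> a [? ?] [? ?].
have := @ae_diffeo _ _ hI (V * Z)%type (fst @^-1` D) (fst @^-1` D')
  (fun p => (phi p.1, p.2)) (fun p => (psi p.1, p.2)) P.
apply => //.
- by dim_pos.
- exact: lin_open_preim.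
- exact: lin_open_preim.
- exact: ext.
- exact: ext.
- by move=> [v z]; exact: DD'.
- by move=> [v z]; exact: D'D.
- by move=> [v z] Dv; congr pair; exact: K.
- by move=> [v z] Dv; congr pair; exact: K'.
Qed.

(** The inverse of [(v, w) |-> (v, a(v) w + F(v))] has the same form, so that no
    Jacobian has to be inverted. *)
Lemma pullback_ae_affine V W (D : set V) (a : V -> R) (F : V -> W) :
  (0 < dim W)%N -> lin_open D -> (forall v, D v -> a v != 0) ->
  smooth_fun D a -> smooth_map D F ->
  pullback_ae [set p : V * W | D p.1] (fun p => (p.1, a p.1 *: p.2 + F p.1)).
Proof.
move=> W0 oD a0 sa sF.
have VW0 : (0 < dim (V * W)%type)%N by dim_pos.
have lfst : linear (fst : V * W -> V) by move=> ? [? ?] [? ?].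
have lsnd : linear (snd : V * W -> W) by move=> ? [? ?] [? ?].
have oD1 := lin_open_preim lfst oD.
have sav : smooth_fun D (fun v => (a v)^-1) by exact: smooth_funV.
have reg1 (b : V -> R) (G : V -> W) : smooth_fun D b -> smooth_map D G ->
    smooth_map (fst @^-1` D) (fun p : V * W => (p.1, b p.1 *: p.2 + G p.1)).
  move=> sb sG; apply: smooth_map_pair; first exact: (smooth_map_lin oD1 lfst).
  apply: smooth_mapD; last exact: (smooth_map_preim lfst sG).
  apply: smooth_mapZ; first exact: (smooth_fun_preim lfst sb).
  exact: (smooth_map_lin oD1 lsnd).
apply: (@pullback_ae_diffeo _ (fst @^-1` D) (fst @^-1` D) _
   (fun p => (p.1, (a p.1)^-1 *: p.2 + (- (a p.1)^-1) *: F p.1))) => //.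
- exact: reg1.
- apply: (reg1 (fun v => (a v)^-1) (fun v => (- (a v)^-1) *: F v)) => //.
  by apply: smooth_mapZ => //; exact: smooth_funN.
- move=> [v w] Dv /=; rewrite scalerDr scalerA mulVf ?a0 // scale1r scaleNr.
  by rewrite addrK.
- move=> [v w] Dv /=; rewrite scalerDr !scalerA mulrN mulfV ?a0 //.
  by rewrite scale1r scaleN1r subrK.
Qed.

(** Along a generic line of direction [d], [q] is a nonconstant affine function,
    whose value is therefore a coordinate. *)
Lemma ae_zero_set V (d : V) (q a : V -> R) : (0 < dim V)%N ->
  smooth_fun setT q -> smooth_fun setT a -> (forall v r, q (v + r *: d) = q v + r * a v) ->
  ae (fun v => a v != 0) -> ae (fun v => q v != 0).
Proof.
move=> V0 sq sa qa ha; apply: (@ae_direction V d) => //.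
have VR0 : (0 < dim (V * R^o)%type)%N by dim_pos.
pose D : set V := [set v | a v != 0].
have oD : lin_open D.
  have := lin_open_neq0 sa; rewrite (_ : [set v | _] = D) //.
  by apply/seteqP; split=> v //= [].
have sub (f : V -> R) : smooth_fun setT f -> smooth_fun D f by apply: smooth_fun_sub.
have H := @pullback_ae_affine V (R^o : vectType R) D a q isT oD (fun v h => h)
   (sub _ sa) (smooth_map_of_fun (sub _ sq)).
have := pullback_aeE VR0 VR0 H (ae_snd hI V0 (dim_regular_gt0 R) ae_neq0).
move=> /(ae_and hI VR0 (ae_fst _ V0 ha)); apply: (aeW hI VR0) => -[v r] /= [av].
by move=> /(_ av); rewrite qa addrC mulrC.
Qed.

End Pullback.

(** * Almost additive functions *)

Section AlmostAdditive.
Context (R : realType) (I : forall m : nat, set (set 'rV[R]_m)).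
Hypothesis hI : ideal_system I.
Local Notation ae := (ae I).

(** For a fixed [v], the difference [H(v + w) - H(w)] takes the same value [h(v)]
    for almost all [w].  This is clear for almost every [v], and an arbitrary
    [v] is the sum of two such points. *)
Lemma almost_additive (V : vectType R) (G : zmodType) (H : V -> G) :
  (0 < dim V)%N -> ae (fun p : V * V => H (p.1 + p.2) = H p.1 + H p.2) ->
  exists h : V -> G, (forall u v, h (u + v) = h u + h v) /\ ae (fun v => h v = H v).
Proof.
move=> V0 HH.
pose val v g := ae (fun w => H (v + w) - H w = g).
have aeval : ae (fun v => val v (H v)).
  apply: (aeW hI V0 _ (ae_fubini hI V0 V0 HH)) => v; apply: (aeW hI V0) => w /= ->.
  by rewrite addrK.
have val_uniq v g g' : val v g -> val v g' -> g = g'.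
  by move=> h h'; have [w [<- <-]] := ae_ex hI V0 (ae_and hI V0 h h').
have valD u v g g' : val u g -> val v g' -> val (u + v) (g + g').
  move=> /(ae_translate hI v V0) h h'.
  apply: (aeW hI V0 _ (ae_and hI V0 h h')) => w [<- <-].
  by rewrite [w + v]addrC subrKA addrA.
have val_ex v : exists g, val v g.
  have aeN : ae (fun u => val (- u) (H (- u))).
    apply: (ae_linear hI (L := -%R) V0 V0 _ _ aeval) => [a x y|x].
      by rewrite opprD scalerN.
    by exists (- x); rewrite opprK.
  have := ae_translate hI (- v) V0 aeN.
  move=> /(ae_and hI V0 aeval) /(ae_ex hI V0) [u [h1 h2]].
  exists (H u + H (- (u - v))); have := valD _ _ _ _ h1 h2.
  by rewrite opprB subrKC.
have [h hP] := choice val_ex.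
exists h; split=> [u v|]; first exact: val_uniq (hP _) (valD _ _ _ _ (hP u) (hP v)).
by apply: (aeW hI V0 _ aeval) => v; exact: val_uniq.
Qed.

End AlmostAdditive.

(** * Orthogonal pairs *)

Section Geometry.
Context (R : realType) (I : forall m : nat, set (set 'rV[R]_m)).
Hypothesis hI : ideal_system I.
Local Notation ae := (ae I).
Local Notation pullback_ae := (pullback_ae I).
Let R0 := dim_regular_gt0 R.

Lemma pullback_aeT (V W : vectType R) (D : set V) (F : V -> W) : (0 < dim V)%N ->
  pullback_ae D F -> ae D -> pullback_ae setT F.
Proof.
move=> V0 H HD Z P /H H1.
have VZ0 : (0 < dim (V * Z)%type)%N by dim_pos.
move: (ae_and hI VZ0 (ae_fst hI Z V0 HD) H1).
by apply: (aeW hI VZ0) => p [Dp]; move=> /(_ Dp).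
Qed.

(** When [q] is affine with nonzero slope along [d], the value [q(v)] can replace
    the coordinate of [v] along [d]; a statement that does not depend on that
    coordinate otherwise may treat [q(v)] as an independent variable. *)
Lemma ae_level (V : vectType R) (D : set V) (d : V) (q a : V -> R) (P : V -> R -> Prop) :
  (0 < dim V)%N -> smooth_fun D q -> smooth_fun D a -> (forall v, D v -> a v != 0) -> ae D ->
  (forall v r, D v -> q (v + r *: d) = q v + r * a v) ->
  (forall v r s, P (v + r *: d) s <-> P v s) ->
  ae (fun v => P v (q v)) <-> ae (fun p : V * R^o => P p.1 p.2).
Proof.
move=> V0 sq sa a0 HD qa Pd; have oD := smooth_fun_open sq.
have VR0 : (0 < dim (V * R^o)%type)%N by dim_pos.
have aeD := ae_fst hI (R^o : vectType R) V0 HD.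
have sV := smooth_funV a0 sa.
split=> [/(ae_to_direction hI d V0) H|H].
- have A := @pullback_ae_affine R I hI V (R^o : vectType R) D (fun v => (a v)^-1)
    (fun v => - (q v / a v)) R0 oD (fun v Dv => invr_neq0 (a0 v Dv)) sV
    (smooth_map_of_fun (smooth_funN (smooth_funM sq sV))).
  have {}H := pullback_aeE hI VR0 VR0 A H.
  move: (ae_and hI VR0 aeD H); apply: (aeW hI VR0) => -[v s] /= [Dv /(_ Dv)].
  rewrite Pd qa // (_ : q v + _ = s) // -[_ *: _]/(_ * _).
  by rewrite mulrDl mulNr divfK ?a0 // mulrAC mulVf ?a0 // mul1r addrC subrK.
- have A := @pullback_ae_affine R I hI V (R^o : vectType R) D a q R0 oD a0 sa (smooth_map_of_fun sq).
  have {}H := pullback_aeE hI VR0 VR0 A H.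
  apply: (ae_direction hI (d := d) V0).
  move: (ae_and hI VR0 aeD H); apply: (aeW hI VR0) => -[v s] /= [Dv /(_ Dv)].
  by rewrite Pd qa // addrC mulrC.
Qed.

Context (X : vectType R) (B : X -> X -> R^o) (e d : X).
Hypothesis X0 : (0 < dim X)%N.
Hypothesis Br : forall x, linear (B x).
Hypothesis Bsym : forall x y, B x y = B y x.
Hypothesis Bdef : forall x, x != 0 -> B x x != 0.
Hypothesis e0 : e != 0.
Hypothesis d0 : d != 0.
Hypothesis ed : B e d = 0.

Let XX0 : (0 < dim (X * X)%type)%N. Proof. by dim_pos. Qed.
Let XXR0 : (0 < dim (X * X * R^o)%type)%N. Proof. by dim_pos. Qed.
Let XXX0 : (0 < dim (X * X * X)%type)%N. Proof. by dim_pos. Qed.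

Lemma BDr x y z : B x (y + z) = B x y + B x z.
Proof. by have := Br x 1 y z; rewrite !scale1r. Qed.
Lemma B0r x : B x 0 = 0.
Proof. by apply: (addrI (B x 0)); rewrite -BDr !addr0. Qed.
Lemma BZr a x y : B x (a *: y) = a * B x y.
Proof. by have := Br x a y 0; rewrite !addr0 B0r addr0. Qed.
Lemma BNr x y : B x (- y) = - B x y.
Proof. by rewrite -scaleN1r BZr mulN1r. Qed.
Lemma BDl x y z : B (y + z) x = B y x + B z x.
Proof. by rewrite Bsym BDr !(Bsym x). Qed.
Lemma BZl a x y : B (a *: y) x = a * B y x.
Proof. by rewrite Bsym BZr Bsym. Qed.
Lemma BNl x y : B (- y) x = - B y x.
Proof. by rewrite Bsym BNr Bsym. Qed.
Lemma B0l x : B 0 x = 0.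
Proof. by rewrite Bsym B0r. Qed.
Lemma Bl y : linear (B ^~ y).
Proof. by move=> a u v; rewrite BDl BZl. Qed.

Definition BE := (BDr, BDl, BZr, BZl, BNr, BNl, B0r, B0l).

Lemma Bee : B e e != 0. Proof. exact: Bdef. Qed.
Lemma Bdd : B d d != 0. Proof. exact: Bdef. Qed.

(** The projection of [t] on the hyperplane orthogonal to [x], along [e]. *)
Definition oproj x t := t - (B t x / B e x) *: e.

Lemma oproj_ortho x t : B e x != 0 -> B (oproj x t) x = 0.
Proof. by move=> ex; rewrite /oproj !BE; field. Qed.

Lemma oproj_id x t : B t x = 0 -> oproj x t = t.
Proof. by move=> tx; rewrite /oproj tx mul0r scale0r subr0. Qed.

Lemma oproj_shift x t r : B e x != 0 -> oproj x (t + r *: e) = oproj x t.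
Proof.
move=> ex; rewrite /oproj !BE mulrDl mulfK // scalerDl opprD addrACA.
by rewrite subrr addr0.
Qed.

Lemma oproj_scale s x t : s != 0 -> oproj (s *: x) t = oproj x t.
Proof. by move=> s0; rewrite /oproj !BZr -mulf_div divff // mul1r. Qed.

Lemma oprojD x t t' r : oproj x (t + r *: t') = oproj x t + r *: oproj x t'.
Proof.
by rewrite /oproj !BE mulrDl scalerDl scalerBr scalerA opprD addrACA mulrA.
Qed.

Lemma smooth_fun_form (V : vectType R) (D : set V) (F G : V -> X) : lin_open D ->
  smooth_map D F -> smooth_map D G -> smooth_fun D (fun v => B (F v) (G v)).
Proof. by move=> oD; apply: smooth_fun_bilin => //; exact: Bl. Qed.

Lemma smooth_map_oproj (V : vectType R) (D : set V) (F G : V -> X) : lin_open D ->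
  (forall v, D v -> B e (F v) != 0) ->
  smooth_map D F -> smooth_map D G -> smooth_map D (fun v => oproj (F v) (G v)).
Proof.
move=> oD eF sF sG; have se : smooth_map D (fun=> e) by exact: smooth_map_cst.
apply: smooth_mapD => //.
have sd := smooth_funV eF (smooth_fun_form oD se sF).
have s := smooth_funN (smooth_funM (smooth_fun_form oD sG sF) sd).
move: (smooth_mapZ s se); rewrite /smooth_map => H l /H.
by apply: smooth_fun_ext => v _ /=; rewrite scaleNr.
Qed.

(** The parametrizations of this section degenerate on the zero sets of a few
    polynomials.  The next lemmas show that these sets are null. *)
Lemma ae_Be : ae (fun x => B e x != 0).
Proof.
apply: (ae_linear hI (L := B e) X0 R0 (Br e) _ (ae_neq0 hI)) => r.
by exists ((r / B e e) *: e); rewrite BZr divfK // Bee.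
Qed.

Lemma Be_neq0 x : B e x != 0 -> x != 0.
Proof. by apply: contraNneq => ->; rewrite B0r. Qed.

Lemma ae_Bd : ae (fun x => B d x != 0).
Proof.
apply: (ae_linear hI (L := B d) X0 R0 (Br d) _ (ae_neq0 hI)) => r.
by exists ((r / B d d) *: d); rewrite BZr divfK // Bdd.
Qed.

Let lfst (V W : vectType R) : linear (fst : V * W -> V).
Proof. by move=> a [? ?] [? ?]. Qed.
Let lsnd (V W : vectType R) : linear (snd : V * W -> W).
Proof. by move=> a [? ?] [? ?]. Qed.
Let oT (V : vectType R) := @lin_openT R V.

(** The domain of [swap]: both members of the orthogonal pair parametrized by
    [p] lie in the domain of the parametrization. *)
Definition generic (p : X * X) := B e p.1 != 0 /\ B e (oproj p.1 p.2) != 0.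

Lemma ae_generic : ae generic.
Proof.
have s1 : smooth_map setT (fst : X * X -> X) by apply: smooth_map_lin.
have s2 : smooth_map setT (snd : X * X -> X) by apply: smooth_map_lin.
have se : smooth_map setT (fun p : X * X => e) by exact: smooth_map_cst.
have sd : smooth_map setT (fun p : X * X => d) by exact: smooth_map_cst.
(* The numerator of [B e (oproj x t)] is affine in [t]; its slope along [d]
   reduces to one term because [d] is orthogonal to [e]. *)
have H := @ae_zero_set R I hI (X * X)%type (0, d)
  (fun p => B e p.2 * B e p.1 - B p.2 p.1 * B e e) (fun p => - (B d p.1 * B e e)) XX0.
have : ae (fun p : X * X => B e p.2 * B e p.1 - B p.2 p.1 * B e e != 0).
  apply: H.
  - apply: smooth_funD; first by apply: smooth_funM; apply: smooth_fun_form.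
    by apply: smooth_funN; apply: smooth_funM; apply: smooth_fun_form.
  - by apply: smooth_funN; apply: smooth_funM; apply: smooth_fun_form.
  - move=> [x t] r /=; rewrite scaler0 addr0 !BE ed; ring.
  - move: (ae_fst hI X X0 ae_Bd); apply: (aeW hI XX0) => p.
    by move=> dp; rewrite oppr_eq0 mulf_neq0 // Bee.
move=> /(ae_and hI XX0 (ae_fst hI X X0 ae_Be)); apply: (aeW hI XX0) => -[x t] /= [ex N].
split=> //=; apply: contra N => /eqP; rewrite /oproj !BE => E; apply/eqP.
have := congr1 ( *%R (B e x)) E; rewrite mulr0 => <-; field; exact: ex.
Qed.

Lemma lin_open_generic : lin_open generic.
Proof.
have s1 : smooth_map setT (fst : X * X -> X) by apply: smooth_map_lin.
have se : smooth_map setT (fun p : X * X => e) by exact: smooth_map_cst.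
pose D : set (X * X) := [set p | setT p /\ B e p.1 != 0].
have o1 : lin_open D := lin_open_neq0 (smooth_fun_form (@oT _) se s1).
have s3 : smooth_map D (fst : X * X -> X) by apply: smooth_map_lin.
have s4 : smooth_map D (snd : X * X -> X) by apply: smooth_map_lin.
have sQ : smooth_fun D (fun p => B e (oproj p.1 p.2)).
  by apply: (smooth_fun_form o1 (smooth_map_cst e o1)); apply: smooth_map_oproj => // p [].
rewrite (_ : generic = [set p | D p /\ B e (oproj p.1 p.2) != 0]).
  exact: lin_open_neq0.
by apply/seteqP; split=> p; [move=> [? ?]|move=> [[_ ? ?]]].
Qed.

(** [(x, t)] parametrizes the orthogonal pair [(x, oproj x t)], and [swap (x, t)]
    parametrizes [(oproj x t, x)].  The redundant coordinate of the new
    parameter is chosen equal to the one of [t] (both have the same product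
    with [e]), which makes [swap] an involution. *)
Definition swap (p : X * X) : X * X :=
  (oproj p.1 p.2, p.1 + (B e (p.2 - p.1) / B e e) *: e).

Lemma swap_fst p : generic p -> oproj (swap p).1 (swap p).2 = p.1.
Proof.
move=> [ex eQ]; rewrite /swap /= oproj_shift // oproj_id //.
by rewrite Bsym oproj_ortho.
Qed.

Lemma swapK p : generic p -> swap (swap p) = p.
Proof.
move=> gp; have [ex eQ] := gp; rewrite {1}/swap swap_fst //.
case: p gp ex eQ => x t gp /= ex eQ; congr pair.
rewrite -[RHS](subrK (oproj x t)) addrC; congr (_ + _).
rewrite [in RHS]/oproj opprB [RHS]addrCA subrr addr0; congr (_ *: _).
by rewrite /oproj !BE; field; rewrite Bee ex.
Qed.

Lemma generic_swap p : generic p -> generic (swap p).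
Proof.
move=> gp; have [ex eQ] := gp; split=> //=.
by rewrite (_ : oproj _ _ = p.1) //; exact: swap_fst.
Qed.

Lemma pullback_ae_swap : pullback_ae setT swap.
Proof.
apply: pullback_aeT ae_generic => //.
have oG := lin_open_generic.
have s1 : smooth_map generic (fst : X * X -> X) by apply: smooth_map_lin.
have s2 : smooth_map generic (snd : X * X -> X) by apply: smooth_map_lin.
have se : smooth_map generic (fun p : X * X => e) by exact: smooth_map_cst.
have ss : smooth_map generic swap.
  apply: smooth_map_pair; first by apply: smooth_map_oproj => // p [].
  apply: smooth_mapD => //; apply: smooth_mapZ => //.
  apply: smooth_funM; last exact: smooth_fun_cst.
  apply: smooth_fun_form => //; apply: smooth_map_lin => // a [u v] [u' v'] /=.
  by rewrite scalerBr opprD addrACA.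
apply: (pullback_ae_diffeo hI XX0 oG oG ss ss) => //.
- exact: generic_swap.
- exact: generic_swap.
- exact: swapK.
- exact: swapK.
Qed.

Lemma pullback_ae_oproj : pullback_ae setT (fun p : X * X => oproj p.1 p.2).
Proof.
have := pullback_ae_comp pullback_ae_swap (pullback_ae_linear hI XX0 X0
  (@lfst X X) (fun w => ex_intro _ (w, 0) erefl)).
by rewrite (_ : [set v | _] = setT) //; apply/seteqP; split.
Qed.

(** In a statement about almost all orthogonal pairs, the two members may be
    exchanged. *)
Lemma ae_swap_ortho (Z : vectType R) (P : X -> X -> Z -> Prop) :
  ae (fun p : X * X * Z => P p.1.1 (oproj p.1.1 p.1.2) p.2) ->
  ae (fun p : X * X * Z => P (oproj p.1.1 p.1.2) p.1.1 p.2).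
Proof.
move=> /pullback_ae_swap; have XXZ0 : (0 < dim (X * X * Z)%type)%N by dim_pos.
move/(ae_and hI XXZ0 (ae_fst hI Z XX0 ae_generic)); apply: (aeW hI XXZ0).
by move=> [p z] /= [gp /(_ Logic.I)]; rewrite swap_fst.
Qed.

Lemma smooth_map_id (V : vectType R) (D : set V) : lin_open D -> smooth_map D (fun v => v).
Proof. by move=> oD; apply: smooth_map_lin. Qed.

Ltac smooth oD := repeat first
  [ exact: (smooth_fun_cst _ oD) | apply: (smooth_fun_form oD)
  | apply: smooth_funM | apply: smooth_funN | apply: smooth_funD
  | apply: smooth_funV | exact: (smooth_map_id oD)
  | exact: (smooth_map_cst _ oD) | apply: smooth_map_fst
  | apply: smooth_map_snd | apply: smooth_mapD | apply: smooth_mapZ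
  | apply: smooth_fun_of_map ].

Definition nonisotropic (x : X) := B e x != 0 /\ B x x != 0.

Lemma ae_nonisotropic : ae nonisotropic.
Proof.
by apply: (aeW hI X0 _ ae_Be) => x ex; split=> //; exact/Bdef/Be_neq0.
Qed.

Lemma lin_open_nonisotropic : lin_open nonisotropic.
Proof.
have sBe : smooth_fun setT (fun x => B e x) by smooth (@oT X).
have sBB : smooth_fun setT (fun x => B x x) by smooth (@oT X).
rewrite (_ : nonisotropic = [set x | setT x /\ B e x != 0] `&`
    [set x | setT x /\ B x x != 0]).
  by apply: lin_openI; exact: lin_open_neq0.
by apply/seteqP; split=> x [] //; move=> [_ ?] [].
Qed.

(** With [t' = t + s x], the point [s x + oproj x t] is [t' + r e], where [r] is
    an affine function of [s].  So [t'], then [s], can be changed by affine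
    substitutions until the point becomes a linear function of the
    parameters. *)
Lemma sum_normal x t s : nonisotropic x ->
  t + s *: x + (B x x / B e x * s - B (t + s *: x) x / B e x) *: e =
  s *: x + oproj x t.
Proof.
move=> [ex _]; have -> : B x x / B e x * s - B (t + s *: x) x / B e x = - (B t x / B e x).
  by rewrite !BE; field; exact: ex.
by rewrite scaleNr /oproj addrA [t + _]addrC.
Qed.

(** The sum of a generic orthogonal pair is a generic point.  The pairs
    [(s x, oproj x t)] depend on a further parameter [s], for which [sum_normal]
    applies; a generic value of [s] is then fixed, and removed by the
    substitution of [x / s] for [x]. *)
Lemma pullback_ae_sum : pullback_ae setT (fun p : X * X => p.1 + oproj p.1 p.2).
Proof.
move=> Z P HP.
have XXZ0 : (0 < dim (X * X * Z)%type)%N by dim_pos.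
have XXZR0 : (0 < dim (X * X * Z * R^o)%type)%N by dim_pos.
have XRZX0 : (0 < dim (X * R^o * Z * X)%type)%N by dim_pos.
have XZ0 : (0 < dim (X * Z)%type)%N by dim_pos.
have H1 : ae (fun p : X * X * Z * R^o => P (p.1.1.2 + p.2 *: e, p.1.2)).
  apply: (ae_linear hI (L := fun p : X * X * Z * R^o => (p.1.1.2 + p.2 *: e, p.1.2))) HP => //.
    move=> a [[[x t] z] r] [[[x' t'] z'] r']; congr pair.
    rewrite [LHS](_ : _ = a *: t + t' + (a * r + r') *: e) //.
    rewrite [RHS](_ : _ = a *: (t + r *: e) + (t' + r' *: e)) //.
    by rewrite scalerDr addrACA scalerDl !scalerA.
  by move=> [w z]; exists (((0, w), z), 0); rewrite scale0r addr0.
pose D : set (X * X * Z) := (fun v : X * X * Z => v.1.1) @^-1` nonisotropic.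
have oD : lin_open D.
  by apply: lin_open_preim lin_open_nonisotropic => a [[? ?] ?] [[? ?] ?].
have H2 := pullback_aeE hI XXZR0 XXZR0 (pullback_ae_affine hI
  (V := (X * X * Z)%type) (W := (R^o : vectType R)) (D := D)
  (a := fun v => B v.1.1 v.1.1 / B e v.1.1)
  (F := fun v => - (B v.1.2 v.1.1 / B e v.1.1)) R0 oD _ _ _) H1.
have {}H2 : ae (fun p : X * X * Z * R^o => nonisotropic p.1.1.1 ->
   P (p.1.1.2 + (B p.1.1.1 p.1.1.1 / B e p.1.1.1 * p.2 -
        B p.1.1.2 p.1.1.1 / B e p.1.1.1) *: e, p.1.2)).
  apply: H2.
  - by move=> v Dv; have [? ?] : nonisotropic v.1.1 := Dv; rewrite mulf_neq0 // invr_eq0.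
  - by smooth oD; move=> v Dv; case: (Dv : nonisotropic v.1.1).
  - by apply: smooth_map_of_fun; smooth oD; move=> v Dv; case: (Dv : nonisotropic v.1.1).
have {}H2 : ae (fun p : X * R^o * Z * X => nonisotropic p.1.1.1 ->
   P (p.2 + (B p.1.1.1 p.1.1.1 / B e p.1.1.1 * p.1.1.2 -
        B p.2 p.1.1.1 / B e p.1.1.1) *: e, p.1.2)).
  apply: (ae_linear hI (L := fun p : X * R^o * Z * X => (((p.1.1.1, p.2), p.1.2), p.1.1.2))) H2 => //.
  by move=> [[[x t] z] s]; exists (((x, s), z), t).
have H3 := pullback_aeE hI XRZX0 XRZX0 (pullback_ae_affine hI
  (V := (X * R^o * Z)%type) (W := X) (D := setT)
  (a := fun v => 1) (F := fun v => v.1.2 *: v.1.1) X0 (@oT _) _ _ _) H2.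
have {}H3 : ae (fun p : X * R^o * Z * X => nonisotropic p.1.1.1 ->
    P (p.1.1.2 *: p.1.1.1 + oproj p.1.1.1 p.2, p.1.2)).
  apply: (aeW hI XRZX0 _ (H3 _ _ _)).
  - move=> [[[x s] z] t] /= H nx; have {H} := H Logic.I nx.
    by rewrite scale1r sum_normal.
  - by move=> *; exact: oner_neq0.
  - by smooth (@oT (X * R^o * Z)%type).
  - by smooth (@oT (X * R^o * Z)%type).
have RXXZ0 : (0 < dim (R^o * (X * X * Z))%type)%N by dim_pos.
have {H3} : ae (fun p : R^o * (X * X * Z) => nonisotropic p.2.1.1 ->
    P (p.1 *: p.2.1.1 + oproj p.2.1.1 p.2.1.2, p.2.2)).
  apply: (ae_linear hI (L := fun p : R^o * (X * X * Z) => ((p.2.1.1, p.1), p.2.2, p.2.1.2))) H3 => //.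
  by move=> [[[x s] z] t]; exists (s, ((x, t), z)).
(* A generic value of [s] is fixed. *)
move=> /(ae_fubini hI R0 XXZ0) /(ae_and hI R0 (ae_neq0 hI)) /(ae_ex hI R0) [s [s0 H]].
have {}H : ae (fun p : X * X * Z => nonisotropic (s^-1 *: p.1.1) ->
   P (s *: (s^-1 *: p.1.1) + oproj (s^-1 *: p.1.1) p.1.2, p.2)).
  apply: (ae_linear hI (L := fun p : X * X * Z => (s^-1 *: p.1.1, p.1.2, p.2))) H => //.
    move=> a [[x t] z] [[x' t'] z'].
    rewrite [RHS](_ : _ = (a *: (s^-1 *: x) + s^-1 *: x', a *: t + t', a *: z + z')) //.
    by rewrite /= scalerDr !scalerA mulrC.
  move=> [[x t] z]; exists ((s *: x, t), z).
  by rewrite scalerA mulVf // scale1r.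
move: (ae_and hI XXZ0 (ae_fst hI Z XX0 (ae_fst hI X X0 ae_nonisotropic)) H).
apply: (aeW hI XXZ0) => -[[x t] z] /= [[ex xx] {}H] _.
move: H; rewrite oproj_scale ?invr_neq0 // scalerA mulfV // scale1r; apply.
by split; rewrite !BE ?mulf_neq0 ?invr_neq0.
Qed.

(** A generic pair [(x, y)] is obtained by decomposing [y] into a multiple of [x]
    and a vector orthogonal to [x].  The changes of variables are the inverses
    of those of [pullback_ae_sum]. *)
Lemma ae_decompose (P : X -> R -> X -> Prop) :
  ae (fun p : X * X * R^o => P p.1.1 p.2 (p.2 *: p.1.1 + oproj p.1.1 p.1.2)) ->
  ae (fun p : X * X => P p.1 (B p.1 p.2 / B p.1 p.1) p.2).
Proof.
move=> H0.
have XRX0 : (0 < dim (X * R^o * X)%type)%N by dim_pos.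
have {H0} : ae (fun p : X * R^o * X => P p.1.1 p.1.2 (p.1.2 *: p.1.1 + oproj p.1.1 p.2)).
  apply: (ae_linear hI (L := fun p : X * R^o * X => ((p.1.1, p.2), p.1.2))) H0 => //.
  by move=> [[x t] s]; exists ((x, s), t).
have A := pullback_ae_affine hI (V := (X * R^o)%type) (W := X) (D := setT)
  (a := fun v => 1) (F := fun v => (- v.2) *: v.1) X0 (@oT _) _ _ _.
move/(pullback_aeE hI XRX0 XRX0 (A _ _ _)) => H1.
have {A}H1 : ae (fun p : X * R^o * X => P p.1.1 p.1.2
    (p.1.2 *: p.1.1 + oproj p.1.1 (p.2 + (- p.1.2) *: p.1.1))).
  apply: (aeW hI XRX0 _ (H1 _ _ _)).
  - by move=> p /(_ Logic.I) /=; rewrite scale1r.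
  - by move=> *; exact: oner_neq0.
  - by smooth (@oT (X * R^o)%type).
  - by smooth (@oT (X * R^o)%type).
have {}H1 : ae (fun p : X * X * R^o => P p.1.1 p.2
    (p.2 *: p.1.1 + oproj p.1.1 (p.1.2 + (- p.2) *: p.1.1))).
  apply: (ae_linear hI (L := fun p : X * X * R^o => ((p.1.1, p.2), p.1.2))) H1 => //.
  by move=> [[x s] t]; exists ((x, t), s).
pose D : set (X * X) := fst @^-1` nonisotropic.
have oD : lin_open D by apply: lin_open_preim lin_open_nonisotropic.
have A := pullback_ae_affine hI (V := (X * X)%type) (W := (R^o : vectType R)) (D := D)
  (a := fun v => B e v.1 / B v.1 v.1) (F := fun v => B v.2 v.1 / B v.1 v.1) R0 oD _ _ _.
apply: (ae_direction hI (d := (0, e)) XX0).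
have := pullback_aeE hI XXR0 XXR0 (A _ _ _) H1.
have aeN := ae_fst hI (R^o : vectType R) XX0 (ae_fst hI X X0 ae_nonisotropic).
move=> H2; apply: (aeW hI XXR0 _ (ae_and hI XXR0 aeN (H2 _ _ _))).
- move=> [[x t] r] /= [nx /(_ nx)]; have [ex xx] := nx.
  rewrite scaler0 addr0.
  set s := _ + _; have -> : B x (t + r *: e) / B x x = s.
    by rewrite /s !BE (Bsym x t) (Bsym x e) -[_ *: _]/(_ * _); field.
  have -> : s *: x + oproj x (t + - s *: x) = t + r *: e.
    rewrite -sum_normal // scaleNr subrK.
    congr (_ + _ *: _); rewrite /s -[_ *: _]/(_ * _); field.
    by rewrite ex xx.
  by [].
- by move=> v [ex xx]; rewrite mulf_neq0 // invr_eq0.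
- by smooth oD; move=> v [].
- by apply: smooth_map_of_fun; smooth oD; move=> v [].
Qed.

(** For a generic [x] the inner product with [x] is a coordinate, along [e], of
    the second variable. *)
Lemma ae_ip (Z : vectType R) (P : X -> R -> Z -> Prop) :
  ae (fun p : X * X * Z => P p.1.1 (B p.1.1 p.1.2) p.2) <->
  ae (fun p : X * R^o * Z => P p.1.1 p.1.2 p.2).
Proof.
have XXZ0 : (0 < dim (X * X * Z)%type)%N by dim_pos.
have XRZ0 : (0 < dim (X * R^o * Z)%type)%N by dim_pos.
have XXZR0 : (0 < dim (X * X * Z * R^o)%type)%N by dim_pos.
pose D : set (X * X * Z) := [set v | setT v /\ B e v.1.1 != 0].
have sBe : smooth_fun setT (fun v : X * X * Z => B e v.1.1).
  by smooth (@oT (X * X * Z)%type).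
have oD : lin_open D by exact: lin_open_neq0.
have L := @ae_level (X * X * Z)%type D ((0, e), 0) (fun v => B v.1.1 v.1.2)
  (fun v => B e v.1.1) (fun v s => P v.1.1 s v.2) XXZ0.
have {}L : ae (fun p : X * X * Z => P p.1.1 (B p.1.1 p.1.2) p.2) <->
  ae (fun p : X * X * Z * R^o => P p.1.1.1 p.2 p.1.2).
  apply: L.
  - by smooth oD.
  - by smooth oD.
  - by move=> v [].
  - by have := ae_fst hI Z XX0 (ae_fst hI X X0 ae_Be); apply: (aeW hI XXZ0).
  - by move=> [[x y] z] r _ /=; rewrite scaler0 addr0 !BE (Bsym x e).
  - by move=> [[x y] z] r s /=; rewrite !scaler0 !addr0.
rewrite L; split=> H.
- apply: (ae_drop hI (W := X) XRZ0 X0).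
  have XRZX0 : (0 < dim (X * R^o * Z * X)%type)%N by dim_pos.
  apply: (ae_linear hI (L := fun p : X * R^o * Z * X => ((p.1.1.1, p.2), p.1.2, p.1.1.2))) H => //.
  by move=> [[[x y] z] s]; exists (((x, s), z), y).
- apply: (ae_linear hI (L := fun p : X * X * Z * R^o => ((p.1.1.1, p.2), p.1.2))) H => //.
  by move=> [[x s] z]; exists (((x, 0), z), s).
Qed.

(** For generic [x] and [y], the inner product of [x] with a vector orthogonal
    to [y] is arbitrary.  This fails in dimension 1; the vector [d], orthogonal
    to [e], is the direction in which the orthogonal vector varies. *)
Lemma ae_ip_oproj (P : X -> X -> R -> Prop) :
  ae (fun p : X * X * X => P p.1.1 p.1.2 (B p.1.1 (oproj p.1.2 p.2))) ->
  ae (fun p : X * X * R^o => P p.1.1 p.1.2 p.2).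
Proof.
have XXXR0 : (0 < dim (X * X * X * R^o)%type)%N by dim_pos.
pose D1 : set (X * X * X) := [set v | setT v /\ B e v.1.2 != 0].
have oD1 : lin_open D1.
  by apply: lin_open_neq0; smooth (@oT (X * X * X)%type).
pose a (v : X * X * X) : R := B v.1.1 (oproj v.1.2 d).
have sa : smooth_fun D1 a.
  apply: (smooth_fun_form oD1); first by smooth oD1.
  by apply: smooth_map_oproj => //; [move=> v []|smooth oD1|smooth oD1].
pose D : set (X * X * X) := [set v | D1 v /\ a v != 0].
have oD : lin_open D by exact: lin_open_neq0.
have DD1 : D `<=` D1 by move=> v [].
have aeD : ae D.
  (* The numerator of [a], seen as an affine function of [x] along [d]. *)
  have H := @ae_zero_set R I hI (X * X)%type (d, 0)
    (fun p => B p.1 d * B e p.2 - B d p.2 * B p.1 e) (fun p => B d d * B e p.2) XX0.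
  have : ae (fun p : X * X => B p.1 d * B e p.2 - B d p.2 * B p.1 e != 0).
    apply: H.
    - by smooth (@oT (X * X)%type).
    - by smooth (@oT (X * X)%type).
    - by move=> [x y] r /=; rewrite scaler0 addr0 !BE (Bsym d e) ed; ring.
    - have := ae_snd hI X0 X0 ae_Be; apply: (aeW hI XX0) => p ep.
      by rewrite mulf_neq0 // Bdd.
  move=> /(ae_and hI XX0 (ae_snd hI X0 X0 ae_Be)) /(ae_fst hI X XX0).
  apply: (aeW hI XXX0) => -[[x y] u] /= [ey N]; split=> //=.
  apply: contra N => /eqP; rewrite /a /oproj /= !BE => E; apply/eqP.
  by have := congr1 ( *%R (B e y)) E; rewrite mulr0 => <-; field; exact: ey.
have L := @ae_level (X * X * X)%type D ((0, 0), d) (fun v => B v.1.1 (oproj v.1.2 v.2))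
  a (fun v s => P v.1.1 v.1.2 s) XXX0.
move/L => H; apply: (ae_drop hI (W := X) XXR0 X0).
have XXRX0 : (0 < dim (X * X * R^o * X)%type)%N by dim_pos.
have {}H : ae (fun p : X * X * X * R^o => P p.1.1.1 p.1.1.2 p.2).
  apply: H => //.
  - apply: (smooth_fun_form oD); first by smooth oD.
    by apply: smooth_map_oproj => //; [move=> v [[]]|smooth oD|smooth oD].
  - exact: smooth_fun_sub oD DD1 sa.
  - by move=> v [].
  - by move=> [[x y] u] r _ /=; rewrite scaler0 !addr0 oprojD BDr BZr.
  - by move=> [[x y] u] r s /=; rewrite scaler0 !addr0.
apply: (ae_linear hI (L := fun p : X * X * R^o * X => ((p.1.1, p.2), p.1.2))) H => //.
by move=> [[[x y] u] s]; exists (((x, y), s), u).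
Qed.

Lemma ae_ip2 (P : X -> R -> Prop) :
  ae (fun p : X * X => P p.1 (B p.1 p.2)) <-> ae (fun p : X * R^o => P p.1 p.2).
Proof.
have XR0 : (0 < dim (X * R^o)%type)%N by dim_pos.
split=> H.
- have : ae (fun p : X * R^o * R^o => P p.1.1 p.1.2).
    by apply/(ae_ip (fun x s (_ : R^o) => P x s)); exact: (ae_fst hI _ XX0 H).
  exact: (ae_drop hI XR0 R0).
- have : ae (fun p : X * X * R^o => P p.1.1 (B p.1.1 p.1.2)).
    by apply/(ae_ip (fun x s (_ : R^o) => P x s)); exact: (ae_fst hI _ XR0 H).
  exact: (ae_drop hI XX0 R0).
Qed.

Context (G : zmodType).

(** * The additive functions associated with an almost orthogonally additive one *)

Section Existence.
Context (f : X -> G).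
Hypothesis f_ortho :
  ae (fun p : X * X => f (p.1 + oproj p.1 p.2) = f p.1 + f (oproj p.1 p.2)).

Definition cauchy_diff x y := f (x + y) - f x - f y.

(** The Cauchy difference of [f] at [x] and at the multiple of [x] whose inner
    product with [x] is [s]. *)
Definition line_diff x s := f ((s / B x x + 1) *: x) - f ((s / B x x) *: x) - f x.

Let XR0 : (0 < dim (X * R^o)%type)%N. Proof. by dim_pos. Qed.

Lemma f_ortho_scale :
  ae (fun p : X * X * R^o =>
    f (p.2 *: p.1.1 + oproj p.1.1 p.1.2) = f (p.2 *: p.1.1) + f (oproj p.1.1 p.1.2)).
Proof.
have RXX0 : (0 < dim (R^o * X * X)%type)%N by dim_pos.
have RX0 : (0 < dim (R^o * X)%type)%N by dim_pos.
pose D : set (R^o : vectType R) := [set v | setT v /\ v != 0].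
have s1 : smooth_fun (@setT (R^o : vectType R)) (fun v => v).
  by apply: smooth_fun_of_map; apply: smooth_map_id.
have oD : lin_open D by exact: lin_open_neq0.
have A := pullback_ae_affine hI (V := (R^o : vectType R)) (W := X) (D := D)
  (a := fun s => s) (F := fun s => 0) X0 oD _ _ _.
have {A} := A _ _ _ X (fun p => f (p.1.2 + oproj p.1.2 p.2) = f p.1.2 + f (oproj p.1.2 p.2)).
move=> A.
have {}A : ae (fun p : R^o * X * X =>
    f (p.1.1 *: p.1.2 + oproj p.1.2 p.2) = f (p.1.1 *: p.1.2) + f (oproj p.1.2 p.2)).
  have N : ae (fun p : R^o * X * X => p.1.1 != 0).
    exact: (ae_fst hI X RX0 (ae_fst hI X R0 (ae_neq0 hI))).
  apply: (aeW hI RXX0 _ (ae_and hI RXX0 N (A _ _ _ _))).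
  - move=> [[s x] t] /= [s0 /(_ (conj Logic.I s0))].
    by rewrite addr0 oproj_scale.
  - by move=> s [].
  - exact: smooth_fun_sub s1.
  - exact: smooth_map_cst.
  - apply: (ae_linear hI (L := fun p : R^o * X * X => (p.1.2, p.2))) f_ortho => //.
    by move=> [x t]; exists ((0, x), t).
apply: (ae_linear hI (L := fun p : X * X * R^o => ((p.2, p.1.1), p.1.2))) A => //.
by move=> [[s x] t]; exists ((x, t), s).
Qed.

(** With [y = s x + z] and [z] orthogonal to [x], the term [f(z)] cancels in the
    difference of [f(x + y) = f((s + 1) x) + f(z)] and [f(y) = f(s x) + f(z)]. *)
Lemma cauchy_diff_line :
  ae (fun p : X * X => cauchy_diff p.1 p.2 = line_diff p.1 (B p.1 p.2)).
Proof.
have H1 := f_ortho_scale.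
have := ae_translate hI ((0, 0, 1) : X * X * R^o) XXR0 H1.
move=> /(ae_and hI XXR0 H1) H2.
have := @ae_decompose (fun x s y => f (x + y) - f y = f ((s + 1) *: x) - f (s *: x)).
move=> H; apply: (aeW hI XX0 _ (H _)).
  by move=> [x y] /= E; rewrite /cauchy_diff /line_diff addrAC E.
apply: (aeW hI XXR0 _ H2) => -[[x t] s] /= [E1].
rewrite !addr0 => E2.
have -> : x + (s *: x + oproj x t) = (s + 1) *: x + oproj x t.
  by rewrite scalerDl scale1r addrA [x + _]addrC.
by rewrite E2 E1 opprD addrACA subrr addr0.
Qed.

Lemma cauchy_diff_cocycle x y z :
  cauchy_diff (x + y) z + cauchy_diff x y =
  cauchy_diff x (y + z) + cauchy_diff y z.
Proof.
have E (a b c u w : G) : a - c - b + (b - u - w) = a - c - u - w.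
  by rewrite -[b - u - w]addrA subrKA addrA.
by rewrite /cauchy_diff [_ - f z]addrAC !E addrA [_ - f z - f x]addrAC [LHS]addrAC.
Qed.

Lemma cauchy_diffC x y : cauchy_diff x y = cauchy_diff y x.
Proof. by rewrite /cauchy_diff [x + y]addrC addrAC. Qed.

(** Both sides are the Cauchy difference, which is symmetric. *)
Lemma line_diff_sym :
  ae (fun p : X * X => line_diff p.1 (B p.1 p.2) = line_diff p.2 (B p.1 p.2)).
Proof.
have := ae_and hI XX0 cauchy_diff_line (ae_swap hI X0 cauchy_diff_line).
apply: (aeW hI XX0) => -[x y] /= [<- E].
by rewrite cauchy_diffC E Bsym.
Qed.

(** If [z] is orthogonal to [y], then [x] and [x + z] have the same inner product
    [s] with [y], and [line_diff_sym] equates their values at [s] with the one of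
    [y].  Viewed from [z], the vector [y] is a generic vector orthogonal to [z]
    ([ae_swap_ortho]), so that [s] is generic ([ae_ip_oproj]). *)
Lemma line_diff_shift :
  ae (fun p : X * X * R^o => line_diff p.1.1 p.2 = line_diff (p.1.1 + p.1.2) p.2).
Proof.
apply: (@ae_ip_oproj (fun x y s => line_diff x s = line_diff (x + y) s)).
pose D : set (X * X) := [set p | setT p /\ B e p.1 != 0].
have oD : lin_open D by apply: lin_open_neq0; smooth (@oT (X * X)%type).
have aeD : ae D by apply: (aeW hI XX0 _ (ae_fst hI X X0 ae_Be)).
have A := pullback_ae_affine hI (V := (X * X)%type) (W := X) (D := D)
  (a := fun s => 1) (F := fun p => oproj p.1 p.2) X0 oD _ _ _.
pose P (p : X * X * X) := line_diff p.2 (B p.2 p.1.1) = line_diff p.1.1 (B p.2 p.1.1).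
have HP : ae P.
  apply: (ae_linear hI (L := fun p : X * X * X => (p.2, p.1.1))) line_diff_sym => //.
  by move=> [x y]; exists ((y, 0), x).
have HQ : ae (fun p : X * X * X => P (p.1, p.2 + oproj p.1.1 p.1.2)).
  apply: (aeW hI XXX0 _ (ae_and hI XXX0 (ae_fst hI X XX0 aeD)
    (pullback_aeE hI XXX0 XXX0 (A _ _ _) HP))).
  - by move=> [[y t] x] /= [Dy /(_ Dy)]; rewrite scale1r.
  - by move=> *; exact: oner_neq0.
  - exact: smooth_fun_cst.
  - by apply: smooth_map_oproj => //; [move=> v []|smooth oD|smooth oD].
have H : ae (fun p : X * X * X => line_diff p.2 (B p.2 p.1.1) =
    line_diff (p.2 + oproj p.1.1 p.1.2) (B p.2 p.1.1)).
  have := ae_and hI XXX0 (ae_fst hI X XX0 aeD) (ae_and hI XXX0 HP HQ).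
  apply: (aeW hI XXX0) => -[[y t] x]; rewrite /P /= => -[[_ ey] [E1]].
  by rewrite BDl oproj_ortho // addr0 E1.
have := @ae_swap_ortho X (fun y z x => line_diff x (B x y) = line_diff (x + z) (B x y)) H.
apply: (ae_linear hI (L := fun p : X * X * X => ((p.1.2, p.2), p.1.1))) => //.
by move=> [[y u] x]; exists ((x, y), u).
Qed.

Lemma line_diff_const : exists c : R -> G,
  ae (fun p : X * R^o => line_diff p.1 p.2 = c p.2).
Proof.
have XXR0' : (0 < dim (X * (X * R^o))%type)%N by dim_pos.
have H : ae (fun p : X * (X * R^o) => line_diff p.2.1 p.2.2 = line_diff p.1 p.2.2).
  have H := ae_linear hI (L := fun p : X * (X * R^o) =>
    ((p.2.1, p.1 - p.2.1), p.2.2)) XXR0' XXR0 _ _ line_diff_shift.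
  apply: (aeW hI XXR0' _ (H _ _)) => [[x0 [x s]]|a [x0 [x s]] [y0 [y s']]|[[x y] s]].
  - by rewrite /= addrCA subrr addr0.
  - rewrite [RHS](_ : _ = ((a *: x + y, a *: (x0 - x) + (y0 - y)), a *: s + s')) //.
    by rewrite /= scalerBr opprD addrACA.
  - by exists (x + y, (x, s)); rewrite /= [x + y]addrC addrK.
have [x0 Hx0] := ae_ex hI X0 (ae_fubini hI X0 XR0 H).
by exists (line_diff x0).
Qed.

Lemma cauchy_diff_ip : exists c : R -> G,
  ae (fun p : X * X => cauchy_diff p.1 p.2 = c (B p.1 p.2)).
Proof.
have [c Hc] := line_diff_const; exists c.
have /(ae_and hI XX0 cauchy_diff_line) := (ae_ip2 (fun x s => line_diff x s = c s)).2 Hc.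
by apply: (aeW hI XX0) => p [->].
Qed.

(** The cocycle identity at [x], [z], [y], where [z] is orthogonal to [x], so that
    [<x|y + z> = <x|y>] and the Cauchy difference at [(x, z)] is 0. *)
Lemma cauchy_diff_additive (c : R -> G) :
  ae (fun p : X * X => cauchy_diff p.1 p.2 = c (B p.1 p.2)) ->
  ae (fun p : R^o * R^o => c (p.1 + p.2) = c p.1 + c p.2).
Proof.
move=> Hc.
have RR0 : (0 < dim (R^o * R^o)%type)%N by dim_pos.
have RRX0 : (0 < dim (R^o * R^o * X)%type)%N by dim_pos.
have XRR0 : (0 < dim (X * R^o * R^o)%type)%N by dim_pos.
have aeX : ae (fun p : X * X * X => B e p.1.1 != 0).
  exact: (ae_fst hI X XX0 (ae_fst hI X X0 ae_Be)).
pose D : set (X * X) := [set p | setT p /\ B e p.1 != 0].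
have oD : lin_open D by apply: lin_open_neq0; smooth (@oT (X * X)%type).
have A := pullback_ae_affine hI (V := (X * X)%type) (W := X) (D := D)
  (a := fun s => 1) (F := fun p => oproj p.1 p.2) X0 oD _ _ _.
have g1 : ae (fun p : X * X * X =>
    f (p.1.1 + oproj p.1.1 p.1.2) = f p.1.1 + f (oproj p.1.1 p.1.2)).
  exact: (ae_fst hI X XX0 f_ortho).
have g2 : ae (fun p : X * X * X => let u := p.1.1 + oproj p.1.1 p.1.2 in
    cauchy_diff u p.2 = c (B u p.2)).
  by apply: (aeW hI XXX0 _ (pullback_ae_sum Hc)) => p /(_ Logic.I).
have g3 : ae (fun p : X * X * X => let u := oproj p.1.1 p.1.2 in
    cauchy_diff u p.2 = c (B u p.2)).
  by apply: (aeW hI XXX0 _ (pullback_ae_oproj Hc)) => p /(_ Logic.I).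
have g4 : ae (fun p : X * X * X => cauchy_diff p.1.1 p.2 = c (B p.1.1 p.2)).
  apply: (ae_linear hI (L := fun p : X * X * X => (p.1.1, p.2))) Hc => //.
  by move=> [x y]; exists ((x, 0), y).
have g5 : ae (fun p : X * X * X => let y := p.2 + oproj p.1.1 p.1.2 in
    cauchy_diff p.1.1 y = c (B p.1.1 y)).
  apply: (aeW hI XXX0 _ (ae_and hI XXX0 aeX
    (pullback_aeE hI XXX0 XXX0 (A _ _ _) g4))).
  - by move=> [[x t] y] /= [ex /(_ (conj Logic.I ex))]; rewrite scale1r.
  - by move=> *; exact: oner_neq0.
  - exact: smooth_fun_cst.
  - by apply: smooth_map_oproj => //; [move=> v []|smooth oD|smooth oD].
have H : ae (fun p : X * X * X => c (B p.1.1 p.2 + B p.2 (oproj p.1.1 p.1.2)) =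
    c (B p.1.1 p.2) + c (B p.2 (oproj p.1.1 p.1.2))).
  have := ae_and hI XXX0 g1 (ae_and hI XXX0 g2 (ae_and hI XXX0 g3 g5)).
  move=> /(ae_and hI XXX0 aeX).
  apply: (aeW hI XXX0) => -[[x t] y] /= [ex [E1 [E2 [E3 E5]]]].
  set z := oproj x t in E1 E2 E3 E5 *.
  have zx : B z x = 0 by exact: oproj_ortho.
  rewrite [B y z]Bsym -BDl -E2 -E3.
  have -> : c (B x y) = cauchy_diff x (y + z) by rewrite E5 BDr [B x z]Bsym zx addr0.
  have xz0 : cauchy_diff x z = 0 by rewrite /cauchy_diff E1 addrAC addrK subrr.
  by rewrite [y + z]addrC -cauchy_diff_cocycle xz0 addr0.
have {}H : ae (fun p : X * X * R^o => c (B p.1.2 p.1.1 + p.2) = c (B p.1.2 p.1.1) + c p.2).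
  apply: (@ae_ip_oproj (fun y x s => c (B x y + s) = c (B x y) + c s)).
  apply: (ae_linear hI (L := fun p : X * X * X => ((p.1.2, p.2), p.1.1))) H => //.
  by move=> [[x t] y]; exists ((y, x), t).
have {}H : ae (fun p : X * X * R^o => c (B p.1.1 p.1.2 + p.2) = c (B p.1.1 p.1.2) + c p.2).
  by apply: (aeW hI XXR0 _ H) => p; rewrite Bsym.
have {}H := (@ae_ip (R^o : vectType R) (fun x s r => c (s + r) = c s + c r)).1 H.
apply: (ae_drop hI (W := X) RR0 X0).
apply: (ae_linear hI (L := fun p : R^o * R^o * X => ((p.2, p.1.1), p.1.2))) H => //.
by move=> [[x s] r]; exists ((s, r), x).
Qed.

(** Since [<x + y|x + y>/2 = <x|x>/2 + <y|y>/2 + <x|y>], the function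
    [x |-> m(<x|x>/2)] has the same Cauchy difference as [f], almost
    everywhere. *)
Lemma ortho_extension : exists g : X -> G,
  (forall x y, B x y = 0 -> g (x + y) = g x + g y) /\ ae (fun x => f x = g x).
Proof.
have [c Hc] := cauchy_diff_ip.
have [m [mD cm]] := almost_additive hI (V := (R^o : vectType R)) R0 (cauchy_diff_additive Hc).
have m0 : m 0 = 0 by apply: (addrI (m 0)); rewrite -mD !addr0.
have Hm : ae (fun p : X * X => cauchy_diff p.1 p.2 = m (B p.1 p.2)).
  have := (ae_ip2 (fun _ s => m s = c s)).2 (ae_snd hI X0 R0 cm).
  by move=> /(ae_and hI XX0 Hc); apply: (aeW hI XX0) => p [-> ->].
pose q x := m (B x x / 2).
have qD x y : q (x + y) = q x + q y + m (B x y).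
  by rewrite /q -!mD; congr m; rewrite !BE (Bsym y x); field.
have HF : ae (fun p : X * X => f (p.1 + p.2) - q (p.1 + p.2) =
    (f p.1 - q p.1) + (f p.2 - q p.2)).
  apply: (aeW hI XX0 _ Hm) => -[x y] /= E.
  have -> : f (x + y) = f x + f y + cauchy_diff x y.
    by rewrite /cauchy_diff -[f (x + y) - f x - f y]addrA -opprD subrKC.
  by rewrite qD E opprD addrA [_ - (q x + q y)]addrAC addrK opprD addrACA.
have [b [bD bE]] := almost_additive hI (H := fun x => f x - q x) X0 HF.
exists (fun x => q x + b x); split=> [x y xy|].
  by rewrite qD xy m0 addr0 bD addrACA.
by apply: (aeW hI X0 _ bE) => x ->; rewrite addrC subrK.
Qed.

End Existence.

(** * Uniqueness *)

(** Let [p] be the component of [v] orthogonal to [y].  Then [p + x] is orthogonal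
    to [y] too, and the four values split along [y] and its complement. *)
Lemma ortho_rectangle (h : X -> G) : (forall x y, B x y = 0 -> h (x + y) = h x + h y) ->
  forall v x y, B x y = 0 -> h v + h (v + x + y) = h (v + x) + h (v + y).
Proof.
move=> hD v x y xy; have [->|y0] := eqVneq y 0; first by rewrite !addr0 addrC.
have [s [p [Ev yp]]] : exists s p, v = s *: y + p /\ forall r, B (r *: y) p = 0.
  exists (B v y / B y y), (v - (B v y / B y y) *: y); split=> [|r].
    by rewrite addrC subrK.
  by rewrite !BE (Bsym y v); field; exact: Bdef.
have ypx r : B (r *: y) (p + x) = 0 by rewrite BDr yp add0r BZl Bsym xy mulr0.
have -> : v + x + y = (s + 1) *: y + (p + x).
  by rewrite scalerDl scale1r {1}Ev -!addrA; congr (_ + _); rewrite addrA addrC.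
have -> : v + x = s *: y + (p + x) by rewrite {1}Ev addrA.
have -> : v + y = (s + 1) *: y + p.
  by rewrite scalerDl scale1r {1}Ev addrAC.
rewrite {1}Ev (hD _ _ (yp s)) (hD _ _ (yp (s + 1))) (hD _ _ (ypx s)).
by rewrite (hD _ _ (ypx (s + 1))) addrACA [RHS]addrACA [h p + _]addrC.
Qed.

Lemma ortho_unique (h : X -> G) : (forall x y, B x y = 0 -> h (x + y) = h x + h y) ->
  ae (fun x => h x = 0) -> forall v, h v = 0.
Proof.
move=> hD h0 v; have hv : ae (fun x => h (v + x) = 0).
  by apply: (aeW hI X0 _ (ae_translate hI v X0 h0)) => x; rewrite addrC.
have H2 := pullback_aeE hI XX0 X0 pullback_ae_oproj hv.
have H3 := pullback_aeE hI XX0 X0 pullback_ae_sum hv.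
have [[x t] /= [ex [h1 [h2 h3]]]] := ae_ex hI XX0 (ae_and hI XX0
  (ae_fst hI X X0 ae_Be) (ae_and hI XX0 (ae_fst hI X X0 hv) (ae_and hI XX0 H2 H3))).
have := ortho_rectangle hD v (x := x) (y := oproj x t).
rewrite -addrA h1 (h2 Logic.I) (h3 Logic.I) !addr0; apply.
by rewrite Bsym oproj_ortho.
Qed.

End Geometry.

(** * The chart of the manifold of orthogonal pairs *)

Section Chart.
Context (R : realType).

Lemma mul_pid_mxE m N p (z : 'rV[R]_N) (j : 'I_p) (jN : (j < N)%N) :
  (z *m (pid_mx m : 'M[R]_(N, p))) 0 j = if (j < m)%N then z 0 (Ordinal jN) else 0.
Proof.
rewrite mxE (bigD1 (Ordinal jN)) //= big1 ?addr0 => [|i ij].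
  by rewrite mxE eqxx /=; case: ifP; rewrite ?mulr1 ?mulr0.
rewrite mxE (_ : (i == j :> nat) = false) ?mulr0 //.
by apply/negP => /eqP E; move/eqP: ij; apply; exact: val_inj.
Qed.

Lemma slice_ord_maxP N (z : 'rV[R]_N.+1) : @slice R N N.+1 z <-> z 0 ord_max = 0.
Proof.
split=> [[x _ <-]|z0].
  rewrite mxE big1 // => i _; rewrite mxE.
  by rewrite /= ltn_eqF ?mulr0 /= ?ltn_ord.
exists (@slice_coord R N N.+1 z) => //; apply/rowP => j.
have [jN|jN] := ltnP j N.
  rewrite mul_pid_mxE jN /slice_coord mul_pid_mxE => [|H]; first exact: ltnW.
  by rewrite /= jN; congr (z _ _); exact: val_inj.
have -> : j = ord_max by apply: val_inj; apply/eqP; rewrite eqn_leq jN -ltnS ltn_ord.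
rewrite z0 mxE big1 // => i _; rewrite [pid_mx _ _ _]mxE.
by rewrite /= ltn_eqF ?mulr0 /= ?ltn_ord.
Qed.

(** In codimension 1 the slice is the hyperplane on which the last coordinate
    vanishes. *)
Lemma sliceP N (z : 'rV[R]_N) (i : 'I_N) : i = N.-1 :> nat ->
  @slice R N.-1 N z <-> z 0 i = 0.
Proof.
case: N z i => [z []//|N z i /= iN].
have -> : i = ord_max by exact: val_inj.
exact: slice_ord_maxP.
Qed.

Lemma slice_coord_delta N (i : 'I_N) : i = N.-1 :> nat ->
  @slice_coord R N.-1 N (delta_mx 0 i) = 0.
Proof.
move=> iN; apply/rowP => j; rewrite !mxE big1 // => u _; rewrite !mxE eqxx /=.
have [->|] := eqVneq u i; last by rewrite mul0r.
by rewrite iN ltnn andbF mulr0.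
Qed.

Lemma slice_coord_surj N (w : 'rV[R]_N.-1) : exists z : 'rV[R]_N, slice_coord N.-1 z = w.
Proof.
exists (w *m pid_mx N.-1); rewrite /slice_coord -mulmxA mul_pid_mx minnn.
rewrite (minn_idPr (leq_pred N)) pid_mx_1 mulmx1 //.
Qed.

Context (I : forall m : nat, set (set 'rV[R]_m)).
Hypothesis hI : ideal_system I.
Local Notation ae := (ae I).

Lemma ae_rV m (P : 'rV[R]_m -> Prop) : (0 < m)%N ->
  ae P <-> I [set x | ~ P x].
Proof.
move=> m0.
have lr : linear (r2v : 'rV[R]_(dim 'rV[R]_m) -> 'rV[R]_m) by exact: linearP.
have lv : linear (v2r : 'rV[R]_m -> 'rV[R]_(dim 'rV[R]_m)) by exact: linearP.
have d0 : (0 < dim 'rV[R]_m)%N by rewrite muln_gt0.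
split=> H.
  have := ideal_linear hI m0 lv v2rK r2vK H; move=> /(ideal_subset hI m0); apply.
  by move=> x /=; rewrite v2rK.
have := ideal_linear hI d0 lr r2vK v2rK H; move=> /(ideal_subset hI d0); apply.
by move=> x.
Qed.

Context (n : nat) (hn : (0 < n)%N) (ip : {dot 'rV[R]_n for @idfun R}).

Lemma last_subproof : (n.-1 < n)%N. Proof. by rewrite prednK. Qed.
Definition last_ord : 'I_n := Ordinal last_subproof.
(** The vector along which [oproj] projects: the chart below replaces the last
    coordinate of the second component by the inner product. *)
Definition last_vec : 'rV[R]_n := delta_mx 0 last_ord.
Local Notation l := last_ord.
Local Notation e := last_vec.

Definition dotp (x y : 'rV[R]_n) : R^o := ip x y.

Lemma dotp_linear x : linear (dotp x).
Proof. by move=> a u v; rewrite /dotp linearP. Qed.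

Lemma dotpC x y : dotp x y = dotp y x.
Proof. by rewrite /dotp hermC /= expr0 mul1r. Qed.

Lemma dotp_definite x : x != 0 -> dotp x x != 0.
Proof. by move=> /(neq0_dnorm_gt0 (s := ip)) /lt0r_neq0. Qed.

Definition dotB := BE dotp_linear dotpC.

Lemma last_vecE : e 0 l = 1. Proof. by rewrite mxE !eqxx. Qed.

Lemma last_vec_neq0 : e != 0.
Proof.
by apply/eqP => /rowP /(_ l); rewrite last_vecE mxE => /eqP; rewrite oner_eq0.
Qed.

Definition chart_domain : set 'rV[R]_(n + n) :=
  [set z | dotp e (lsubmx z) != 0].

(** The last coordinate of [(x, y)] is replaced by [<x|y>], which vanishes exactly
    on the orthogonal pairs, and the coordinates of the slice are [x] and the
    other coordinates of [y].  It is a change of variables as long as the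
    coefficient [<e|x>] of the last coordinate of [y] in [<x|y>] is nonzero. *)
Definition chart (z : 'rV[R]_(n + n)) : 'rV[R]_(n + n) :=
  z + (dotp (lsubmx z) (rsubmx z) - rsubmx z 0 l) *: row_mx 0 e.

Definition chart_inv (z : 'rV[R]_(n + n)) : 'rV[R]_(n + n) :=
  z + ((rsubmx z 0 l - dotp (lsubmx z) (rsubmx z)) / dotp e (lsubmx z)) *:
    row_mx 0 e.

Lemma lsubmx_shift (z : 'rV[R]_(n + n)) r : lsubmx (z + r *: row_mx 0 e) = lsubmx z.
Proof. by rewrite linearD linearZ /= row_mxKl scaler0 addr0. Qed.

Lemma rsubmx_shift (z : 'rV[R]_(n + n)) r :
  rsubmx (z + r *: row_mx 0 e) = rsubmx z + r *: e.
Proof. by rewrite linearD linearZ /= row_mxKr. Qed.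

Lemma chart_domain_shift z r :
  chart_domain (z + r *: row_mx 0 e) <-> chart_domain z.
Proof. by rewrite /chart_domain /= lsubmx_shift. Qed.

Lemma chartK z : chart_domain z -> chart_inv (chart z) = z.
Proof.
move=> Dz; rewrite /chart_inv /chart lsubmx_shift rsubmx_shift -addrA -scalerDl.
rewrite [X in X *: _](_ : _ = 0) ?scale0r ?addr0 //.
rewrite !mxE !eqxx mulr1 !dotB (dotpC _ e); field; exact: Dz.
Qed.

Lemma chart_invK z : chart_domain z -> chart (chart_inv z) = z.
Proof.
move=> Dz; rewrite /chart_inv /chart lsubmx_shift rsubmx_shift -addrA -scalerDl.
rewrite [X in X *: _](_ : _ = 0) ?scale0r ?addr0 //.
rewrite !mxE !eqxx mulr1 !dotB (dotpC _ e); field; exact: Dz.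
Qed.

Lemma chart_image : chart @` chart_domain = chart_domain.
Proof.
apply/seteqP; split=> [z [w Dw <-]|z Dz]; first exact/chart_domain_shift.
by exists (chart_inv z); [exact/chart_domain_shift|exact: chart_invK].
Qed.

Lemma chart_diffeo : diffeo_on chart_domain chart.
Proof.
pose V := 'rV[R]_(n + n).
have lT := @lin_openT R V.
have rl (D : set V) : lin_open D -> smooth_map D (fun z : V => lsubmx z).
  by move=> oD; apply: smooth_map_lin => // a u v; rewrite linearP.
have rr (D : set V) : lin_open D -> smooth_map D (fun z : V => rsubmx z).
  by move=> oD; apply: smooth_map_lin => // a u v; rewrite linearP.
have sq (D : set V) : lin_open D -> smooth_fun D (fun z : V => dotp (lsubmx z) (rsubmx z)).
  by move=> oD; apply: (smooth_fun_form dotp_linear dotpC) => //; [exact: rl|exact: rr].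
have se (D : set V) : lin_open D -> smooth_fun D (fun z : V => dotp e (lsubmx z)).
  by move=> oD; apply: (smooth_fun_form dotp_linear dotpC) => //; [exact: smooth_map_cst|exact: rl].
have sl (D : set V) : lin_open D -> smooth_fun D (fun z : V => rsubmx z 0 l).
  by move=> oD; apply: smooth_fun_lin => // a u v; rewrite !mxE.
have oD : lin_open (chart_domain : set V).
  have := lin_open_neq0 (se _ lT).
  by rewrite (_ : [set v | _] = chart_domain) //; apply/seteqP; split=> z //= [].
have oD1 : open chart_domain by apply: (oD (n + n)%N id).
have ri : smooth_map (chart_domain : set V) (fun z => z) by exact: smooth_map_id.
have re : smooth_map (chart_domain : set V) (fun z => row_mx 0 e : V) by exact: smooth_map_cst.
split; rewrite ?chart_image //.
  apply: smooth_map_rV; apply: smooth_mapD => //; apply: smooth_mapZ => //.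
  by apply: smooth_funD; [exact: sq|apply: smooth_funN; exact: sl].
exists chart_inv; split; last exact: chartK.
apply: smooth_map_rV; apply: smooth_mapD => //; apply: smooth_mapZ => //.
apply: smooth_funM; last by apply: smooth_funV => //; exact: se.
by apply: smooth_funD; [exact: sl|apply: smooth_funN; exact: sq].
Qed.

Lemma last_rshift : rshift n l = (n + n).-1 :> nat.
Proof. by rewrite /= -subn1 -[in RHS]subn1 addnBA. Qed.

Lemma bot_slice_chart : slice_chart (n + n).-1 (bot_star ip) chart_domain chart.
Proof.
split; first exact: chart_diffeo.
have E z : chart z 0 (rshift n l) = dotp (lsubmx z) (rsubmx z).
  have -> : chart z 0 (rshift n l) = rsubmx (chart z) 0 l by rewrite [RHS]mxE.
  by rewrite /chart rsubmx_shift !mxE !eqxx mulr1 addrCA subrr addr0.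
apply/seteqP; split=> [z [w [[bw w0] Dw] <-]|z [[w Dw <-]]].
  split; first by exists w.
  by apply/(sliceP _ last_rshift); rewrite E.
move/(sliceP _ last_rshift); rewrite E => bw; exists w => //; split=> //; split=> //.
move=> w0; move: Dw; rewrite /chart_domain /= w0.
by rewrite (_ : lsubmx 0 = 0) ?dotB ?eqxx // linear0.
Qed.

(** In the chart, [(x, oproj x t)] and [(x, t)] have the same slice coordinates,
    since [oproj x t] differs from [t] by a multiple of the last vector. *)
Lemma bot_ideal_ae (G : zmodType) (f : 'rV[R]_n -> G) :
  bot_ideal I ip [set z | bot_star ip z /\
      f (lsubmx z + rsubmx z) <> f (lsubmx z) + f (rsubmx z)] ->
  ae (fun p : 'rV[R]_n * 'rV[R]_n =>
    f (p.1 + oproj dotp e p.1 p.2) = f p.1 + f (oproj dotp e p.1 p.2)).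
Proof.
set A := [set z | _] => -[_ /(_ _ _ bot_slice_chart)].
set N := (X in I X) => HN.
have m0 : (0 < (n + n).-1)%N by rewrite -last_rshift /= ltn_addr.
have X0 : (0 < dim 'rV[R]_n)%N by rewrite muln_gt0.
have XX0 : (0 < dim ('rV[R]_n * 'rV[R]_n)%type)%N by dim_pos.
have W0 : (0 < dim 'rV[R]_(n + n).-1)%N by rewrite muln_gt0.
have : ae (fun w : 'rV[R]_(n + n).-1 => ~ N w).
  apply/ae_rV => //; apply: (ideal_subset hI m0 HN) => w /=.
  exact: contrapT.
move=> {}HN.
have HN' : ae (fun p : 'rV[R]_n * 'rV[R]_n =>
    ~ N (slice_coord (n + n).-1 (row_mx p.1 p.2))).
  apply: (ae_linear hI (L := fun p : 'rV[R]_n * 'rV[R]_n =>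
    slice_coord (n + n).-1 (row_mx p.1 p.2)) XX0 W0 _ _ HN).
    move=> a [x t] [x' t'] /=.
    rewrite /slice_coord -[RHS]/(a *: (row_mx x t *m _) + _).
    by rewrite scalemxAl -mulmxDl scale_row_mx add_row_mx.
  move=> w; have [z <-] := slice_coord_surj w.
  by exists (lsubmx z, rsubmx z); rewrite hsubmxK.
have He := ae_Be hI X0 dotp_linear dotp_definite last_vec_neq0.
have := ae_and hI XX0 (ae_fst hI 'rV[R]_n X0 He) HN'.
apply: (aeW hI XX0) => -[x t] /= [ex Nxt]; apply: contrapT => bad; apply: Nxt.
exists (row_mx x (oproj dotp e x t)).
  split; last by rewrite /chart_domain /= row_mxKl.
  rewrite /A /= row_mxKl row_mxKr; split=> //; split.
    rewrite /bot /= row_mxKl row_mxKr -/(dotp _ _) dotpC.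
    exact: (oproj_ortho dotp_linear dotpC).
  move=> /= /(congr1 lsubmx); rewrite row_mxKl linear0 => x0.
  by move: ex; rewrite x0 dotB eqxx.
rewrite /= /chart; set r := _ - _.
have -> : row_mx x (oproj dotp e x t) =
    row_mx x t + (- (dotp t x / dotp e x)) *: row_mx 0 e.
  by rewrite scale_row_mx scaler0 add_row_mx addr0 scaleNr.
rewrite -addrA -scalerDl /slice_coord mulmxDl -scalemxAl.
have -> : row_mx 0 e = delta_mx 0 (rshift n l) :> 'rV[R]_(n + n).
  by rewrite delta_mx_rshift.
by rewrite [X in _ + _ *: X](slice_coord_delta last_rshift) scaler0 addr0.
Qed.

End Chart.

Theorem mainTheorem1 (R : realType) (n : nat) (hn : (2 <= n)%N)
    (ip : {dot 'rV[R]_n for @idfun R})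
    (I : forall m : nat, set (set 'rV[R]_m)) (hI : ideal_system I)
    (G : zmodType) (f : 'rV[R]_n -> G)
    (hf : bot_ideal I ip
       [set z | bot_star ip z /\
          f (lsubmx z + rsubmx z) <> f (lsubmx z) + f (rsubmx z)]) :
  exists! g : 'rV[R]_n -> G,
    orthogonally_additive ip g /\ I n [set x | f x <> g x].
Proof.
have n0 : (0 < n)%N by exact: ltnW.
have X0 : (0 < dim 'rV[R]_n)%N by rewrite muln_gt0.
pose B := dotp ip; pose e := last_vec R n0.
have e0 : e != 0 := last_vec_neq0 R n0.
have Br : forall x, linear (B x) := dotp_linear ip.
have Bs : forall x y, B x y = B y x := dotpC ip.
have Bd : forall x, x != 0 -> B x x != 0 := @dotp_definite R n ip.
(* The first and the last basis vectors are distinct since [n] is at least 2. *)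
have [d [d0 ed]] : exists d : 'rV[R]_n, d != 0 /\ B e d = 0.
  pose b : 'rV[R]_n := delta_mx 0 (Ordinal n0).
  exists (b - (B e b / B e e) *: e); split; last first.
    by rewrite !(BE Br Bs); field; exact: Bd.
  apply/eqP => /rowP /(_ (Ordinal n0)); rewrite !mxE !eqxx /=.
  rewrite (_ : (_ == _) = false) ?mulr0 ?subr0 => [/eqP|]; first by rewrite oner_eq0.
  by apply/negP => /eqP /(congr1 val) /=; case: (n) hn => [|[]].
have oaE (g : 'rV[R]_n -> G) : orthogonally_additive ip g <->
    forall x y, B x y = 0 -> g (x + y) = g x + g y.
  by rewrite /orthogonally_additive /bot /=; split=> H x y; have := H x y;
    rewrite row_mxKl row_mxKr.
have [g [g_add fg]] := ortho_extension hI X0 Br Bs Bd e0 d0 ed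
  (bot_ideal_ae hI n0 hf).
exists g; split; first by split; [exact/oaE|exact/(ae_rV hI _ n0)].
move=> g' [/oaE g'_add /(ae_rV hI _ n0) fg'].
apply/funext => x; apply/eqP; rewrite -subr_eq0; apply/eqP.
apply: (ortho_unique hI X0 Br Bs Bd e0 d0 ed (h := fun x => g x - g' x)).
  by move=> u v uv; rewrite g_add // g'_add // opprD addrACA.
apply: (aeW hI X0 _ (ae_and hI X0 fg fg')) => u [<- <-].
by rewrite subrr.
Qed.
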